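(* Let $n,k,r$ be nonnegative integers with $r \leq n$. Endow monomials in $\mathbb{Q}[x_1,\dots,x_n]$ with the lexicographic term order. The standard monomial basis of $R_{n,k,r}$ is the set $\mathcal{M}_{n,k,r}$ of $(n,k,r)$-good monomials. The Hilbert series of $R_{n,k,r}$ is $$\mathrm{Hilb}(R_{n,k,r};q) = {n+k-r \brack k}_q \cdot [n]!_q .$$
   Context: For variables $\mathbf{x}_n=(x_1,\dots,x_n)$, $e_d(\mathbf{x}_n)=\sum_{1\le i_1<\cdots<i_d\le n}x_{i_1}\cdots x_{i_d}$ and $h_d(\mathbf{x}_n)=\sum_{1\le i_1\le\cdots\le i_d\le n}x_{i_1}\cdots x_{i_d}$. For nonnegative integers $n,k,r$ with $r\le n$, let $I_{n,k,r}\subseteq\mathbb{Q}[\mathbf{x}_n]$ be the ideal $\langle h_{k+1}(\mathbf{x}_n),h_{k+2}(\mathbf{x}_n),\dots,h_{k+n}(\mathbf{x}_n),\,e_n(\mathbf{x}_n),e_{n-1}(\mathbf{x}_n),\dots,e_{n-r+1}(\mathbf{x}_n)\rangle$ and $R_{n,k,r}:=\mathbb{Q}[\mathbf{x}_n]/I_{n,k,r}$, a graded ring. Lexicographic order: $x_1^{a_1}\cdots x_n^{a_n}<x_1^{b_1}\cdots x_n^{b_n}$ if for some $i$ we have $a_1=b_1,\dots,a_{i-1}=b_{i-1}$ and $a_i<b_i$. The standard monomial basis of $\mathbb{Q}[\mathbf{x}_n]/I$ is the set of monomials not divisible by the leading (greatest) monomial $\mathrm{in}_<(f)$ of any nonzero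 $f\in I$; it descends to a vector space basis of the quotient. For $S=\{s_1<\cdots<s_m\}\subseteq[n]=\{1,\dots,n\}$ the skip monomial is $\mathbf{x}(S)=x_{s_1}^{s_1}x_{s_2}^{s_2-1}\cdots x_{s_m}^{s_m-m+1}$. A monomial $m$ is $(n,k,r)$-good if $\mathbf{x}(S)\nmid m$ for all $S\subseteq[n]$ with $|S|=n-r+1$, and $x_i^{k+i}\nmid m$ for all $1\le i\le n$. $\mathcal{M}_{n,k,r}$ is the set of all $(n,k,r)$-good monomials. For a graded vector space $V=\bigoplus_d V_d$, $\mathrm{Hilb}(V;q)=\sum_d\dim(V_d)q^d$. Also $[m]_q=1+q+\cdots+q^{m-1}$, $[m]!_q=[1]_q[2]_q\cdots[m]_q$, and ${m\brack i}_q=\frac{[m]!_q}{[i]!_q[m-i]!_q}$. *)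

(* Defs.v *)
From HB Require Import structures.
From mathcomp Require Import all_boot all_order all_algebra.
From mathcomp Require Import mpoly.

Set Implicit Arguments.
Unset Strict Implicit.
Unset Printing Implicit Defensive.

Import GRing.Theory.
Local Open Scope ring_scope.

(* The variable x_i, 1 <= i <= n, is 'X_(i - 1), with index in 'I_n.
   The elementary symmetric polynomial e_d(x_1, ..., x_n) is mesym n rat d. *)

Definition hsym (n d : nat) : {mpoly rat[n]} :=
  \sum_(t : d.-tuple 'I_n | sorted leq (map val t)) \prod_(i <- t) 'X_i.

Definition ideal_gen (A : comNzRingType) (G : seq A) (p : A) : Prop :=
  exists c : 'I_(size G) -> A, p = \sum_(i < size G) c i * G`_i.

Definition Igens (n k r : nat) : seq {mpoly rat[n]} :=
  [seq hsym n (k + i) | i <- iota 1 n] ++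
  [seq mesym n rat (n - i) | i <- iota 0 r].

Definition Inkr (n k r : nat) : {mpoly rat[n]} -> Prop :=
  ideal_gen (Igens n k r).
Arguments Inkr : clear implicits.

(* Defined by hand: the canonical order of multinomials is degrevlex. *)
Definition mlex_lt (n : nat) (a b : 'X_{1..n}) : Prop :=
  exists i : 'I_n, (forall j : 'I_n, (j < i)%N -> a j = b j) /\ (a i < b i)%N.

Definition is_lex_lead (n : nat) (f : {mpoly rat[n]}) (u : 'X_{1..n}) : Prop :=
  u \in msupp f /\ forall v, v \in msupp f -> v != u -> mlex_lt v u.

Definition standard_monomial (n : nat) (I : {mpoly rat[n]} -> Prop)
    (m : 'X_{1..n}) : Prop :=
  forall (f : {mpoly rat[n]}) (u : 'X_{1..n}),
    I f -> f != 0 -> is_lex_lead f u -> ~~ (u <= m)%MM.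

(* If i : 'I_n stands for s_j = i + 1 in S, then j - 1 is the number of
   elements of S below i, so that s_j - j + 1 = (i + 1) - (j - 1). *)
Definition skip_monomial (n : nat) (S : {set 'I_n}) : 'X_{1..n} :=
  [multinom (if i \in S then i.+1 - #|[set j in S | (j < i)%N]| else 0)%N
     | i < n].

Definition good_monomial (n k r : nat) (m : 'X_{1..n}) : Prop :=
  (forall S : {set 'I_n}, #|S| = (n - r + 1)%N -> ~~ (skip_monomial S <= m)%MM)
  /\ (forall i : 'I_n, ~~ (U_(i) *+ (k + i.+1) <= m)%MM).
Arguments good_monomial : clear implicits.

(* The degree d component of {mpoly rat[n]} / I is the image of the d.-homog
   polynomials; b represents a basis of it. *)
Definition graded_quot_basis (n : nat) (I : {mpoly rat[n]} -> Prop) (d D : nat)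
    (b : 'I_D -> {mpoly rat[n]}) : Prop :=
  [/\ forall i, b i \is d.-homog,
      forall c : 'I_D -> rat, I (\sum_(i < D) c i *: b i) -> forall i, c i = 0
    & forall p : {mpoly rat[n]}, p \is d.-homog ->
        exists c : 'I_D -> rat, I (p - \sum_(i < D) c i *: b i)].

Definition graded_quot_dim (n : nat) (I : {mpoly rat[n]} -> Prop) (d D : nat)
    : Prop :=
  exists b : 'I_D -> {mpoly rat[n]}, graded_quot_basis I d b.

(* Hilb({mpoly rat[n]} / I; q) is the polynomial H, with 'X as q. *)
Definition has_hilbert_series (n : nat) (I : {mpoly rat[n]} -> Prop)
    (H : {poly rat}) : Prop :=
  forall d : nat, exists2 D : nat, graded_quot_dim I d D & H`_d = D%:R.

Definition qint (m : nat) : {poly rat} := \sum_(i < m) 'X^i.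

Definition qfact (m : nat) : {poly rat} := \prod_(1 <= i < m.+1) qint i.

(* The division of polynomials is exact when i <= m. *)
Definition qbinom (m i : nat) : {poly rat} :=
  qfact m %/ (qfact i * qfact (m - i)).

(* Main.v *)
From HB Require Import structures.
Require Import Defs.
From mathcomp Require Import all_boot all_order all_algebra.
From mathcomp Require Import perm mpoly.
From mathcomp Require Import ring zify.

(** Indices start at 0 in the comments, so that [x_i] for [i < n] is the variable
    of index [i] in ['I_n], and [e_d], [h_d] are taken in all variables unless
    others are given.

    Leads. Every monomial that is not good is divisible by the lexicographic lead
    of an element of the ideal. For a monomial divisible by [x_i ^ (k + i + 1)]
    that element is [h_(k+i+1)(x_i, ..., x_(n-1))] ([Inkr_csym_drop]). For a skip
    monomial it is a combination of minors of the matrices with entries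
    [e_(d-a)(x_i, ..., x_(n-1))], built while [i] runs down from [n] to [0]
    ([skip_lead]). When [i] is outside [S], the minors of size [j + 2] in the
    variables after [x_i] already lie in the ideal of the minors of size [j + 1]
    that include [x_i]. When [i] is in [S], raising the rows of the minors of size
    [j + 1] by one multiplies the lead by [x_i ^ (j + 1)], which is the factor that
    [x_i] has in the skip monomial if [j] indices before [i] are outside [S]. At
    the start the empty condition on rows gives the polynomial 1, and at the end
    the minors are the [e_d] with [d >= n - r + 1]. It follows that the good
    monomials span the quotient, with lexicographic control ([reduce]).

    Independence, by induction on [r]. For [r = 0] the polynomials
    [h_(k+i+1)(x_i, ..., x_(n-1))] are monic in [x_i], and dividing by them one
    after the other is a linear map that kills the ideal and fixes the monomials
    with [x_i]-exponent at most [k + i], which are the good ones ([good_free0]).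
    For the step, the relation between the e's and the h's shows that
    multiplication by [e_(n-r)] maps the ideal for [(k, r)] into that for
    [(k + 1, r)] ([Inkr_lift]). Therefore the good monomials for [(k + 1, r + 1)],
    together with the multiples by [e_(n-r)] of those for [(k, r)], span the
    quotient for [(k + 1, r)]. By Pascal's rule they are as many as the good
    monomials for [(k + 1, r)] ([size_good_list_rec]), which are independent by
    induction; so they are independent too, and this gives the independence of
    the good monomials for [(k + 1, r + 1)] ([good_free_homog]). For [k = 0]
    the ideal is the same for all [r].

    Counting. Goodness can be read off greedily from the exponents
    ([good_nskips]), which gives a recursion in the number of variables for the
    generating function of the good monomials by degree; it sums to the product
    in the theorem ([goodgf_qbinom]).

    Spanning and independence make the good monomials a homogeneous basis of the
    quotient, and the lexicographic control makes it the standard one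
    ([standard_good], [good_standard]). *)

Set Implicit Arguments.
Unset Strict Implicit.
Unset Printing Implicit Defensive.

Import Order.Theory GRing.Theory.
Local Open Scope ring_scope.

(** * Elementary and complete symmetric functions of a list *)

Section ElementaryComplete.
Variable A : comNzRingType.
Implicit Types (x : A) (s : seq A).

Fixpoint esym s (d : nat) : A :=
  match s, d with
  | _, 0 => 1
  | [::], _.+1 => 0
  | x :: s', d'.+1 => esym s' d'.+1 + x * esym s' d'
  end.

Fixpoint csym s : nat -> A :=
  if s is x :: s' then
    fix csym_x d := if d is d'.+1 then csym s' d'.+1 + x * csym_x d' else 1
  else fun d => (d == 0)%:R.

Lemma esym0 s : esym s 0 = 1. Proof. by case: s. Qed.

Lemma esymS x s d : esym (x :: s) d.+1 = esym s d.+1 + x * esym s d.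
Proof. by []. Qed.

Lemma csym0 s : csym s 0 = 1. Proof. by case: s. Qed.

Lemma csymS x s d : csym (x :: s) d.+1 = csym s d.+1 + x * csym (x :: s) d.
Proof. by []. Qed.

(** Adding [x] to the list multiplies the generating function of the signed e's
    by [1 - x t] and divides that of the h's by the same factor, so the convolution
    does not depend on the list. *)
Lemma esym_csym s d :
  \sum_(i < d.+2) (-1) ^+ i * esym s i * csym s (d.+1 - i) = 0.
Proof.
elim: s d => [|x s IH] d.
  rewrite big_ord_recl big1 ?addr0 => [|i _] /=; first by rewrite mulr0.
  by rewrite mulr0 mul0r.
have -> : \sum_(i < d.+2) (-1) ^+ i * esym (x :: s) i * csym (x :: s) (d.+1 - i) =
   \sum_(i < d.+2) (-1) ^+ i * esym s i * csym (x :: s) (d.+1 - i)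
   - x * \sum_(i < d.+1) (-1) ^+ i * esym s i * csym (x :: s) (d - i).
  rewrite big_ord_recl [in RHS]big_ord_recl !esym0 -addrA; congr (_ + _).
  rewrite mulr_sumr -sumrB; apply: eq_bigr => i _.
  rewrite lift0 subSS esymS exprS; ring.
rewrite -[RHS](IH d) big_ord_recr [in RHS]big_ord_recr /= subnn !csym0.
rewrite addrAC; congr (_ + _).
rewrite mulr_sumr -sumrB; apply: eq_bigr => i _.
by rewrite subSn ?csymS -1?ltnS //; ring.
Qed.

Lemma prod_esym s d : (\prod_(x <- s) (1 + x *: 'X))`_d = esym s d.
Proof.
elim: s d => [|x s IH] [|d].
- by rewrite big_nil coef1.
- by rewrite big_nil coef1.
- by rewrite big_cons mulrDl mul1r coefD IH -scalerAl coefZ coefXM mulr0 addr0 !esym0.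
by rewrite big_cons mulrDl mul1r coefD IH -scalerAl coefZ coefXM IH.
Qed.

Lemma esym_over s d : (size s < d)%N -> esym s d = 0.
Proof.
elim: s d => [|x s IH] [|d] //= ltd.
by rewrite !IH ?mulr0 ?addr0 //; lia.
Qed.

End ElementaryComplete.

(** * The variables, and the two families of generators *)

Section Variables.
Variable n : nat.
Local Notation P := {mpoly rat[n]}.

Definition xvars : seq P := [seq 'X_i | i <- enum 'I_n].

Lemma size_xvars : size xvars = n.
Proof. by rewrite size_map size_enum_ord. Qed.

Lemma drop_xvars (i : 'I_n) : drop i xvars = 'X_i :: drop i.+1 xvars.
Proof.
rewrite (drop_nth 0) ?size_xvars //; congr (_ :: _).
by rewrite (nth_map i) ?size_enum_ord // nth_ord_enum.
Qed.

Lemma mesym_esym d : mesym n rat d = esym xvars d.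
Proof.
rewrite -prod_esym /xvars big_map big_enum /=.
under eq_bigr => i _ do rewrite addrC.
rewrite bigA_distr /=.
rewrite coef_sum /mesym big_mkcond /=; apply: eq_bigr => h _.
rewrite -big_mkcondr /=.
rewrite (eq_bigr (fun i => ('X_i)%:P * 'X)); last by move=> i _; rewrite mul_polyC.
rewrite big_split /= -rmorph_prod prodr_const coefCM coefXn eq_sym.
by case: eqP; rewrite (mulr1, mulr0).
Qed.

(** The complete symmetric polynomial in the variables of index at least [i].
    Weakly increasing words bounded below by [i] are paths for [leq] from [i],
    a form that splits along the first letter of the word. *)
Definition paths_sum (i d : nat) : P :=
  \sum_(t : d.-tuple 'I_n | path leq i (map val t)) \prod_(l <- t) 'X_l.

Lemma paths_sum0 i : paths_sum i 0 = 1.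
Proof.
rewrite /paths_sum (big_pred1 [tuple]) ?big_nil // => t.
by rewrite !(tuple0 t).
Qed.

Lemma paths_sumS i d :
  paths_sum i d.+1 = \sum_(l < n | (i <= l)%N) 'X_l * paths_sum l d.
Proof.
rewrite /paths_sum.
under [RHS]eq_bigr => l _ do rewrite mulr_sumr.
rewrite pair_big_dep /=.
rewrite (reindex (fun p : 'I_n * d.-tuple 'I_n => cons_tuple p.1 p.2)) /=.
  by apply: eq_bigr => p _; rewrite big_cons.
exists (fun t => (thead t, behead_tuple t)) => [[l t] _|t _] /=.
  by rewrite theadE; congr (_, _); apply: val_inj.
by rewrite [RHS]tuple_eta.
Qed.

Lemma paths_sum_csym i d : paths_sum i d = csym (drop i xvars) d.
Proof.
elim: d i => [|d IH] i; first by rewrite paths_sum0 csym0.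
case: (leqP n i) => [le_ni|lt_in].
  rewrite paths_sumS big1 ?drop_oversize ?size_xvars // => l.
  by move=> le_il; have := ltn_ord l; rewrite ltnNge (leq_trans le_ni).
have [p Ep] : exists p, p = (n - i)%N by exists (n - i)%N.
elim: p i Ep lt_in => [|p IHp] i Ep lt_in; first by lia.
have E : drop i xvars = _ := drop_xvars (Ordinal lt_in).
rewrite E csymS -E -IH /=.
rewrite paths_sumS (bigD1 (Ordinal lt_in)) //= addrC; congr (_ + _).
rewrite (eq_bigl (fun l : 'I_n => i.+1 <= l)%N); last first.
  by move=> l; rewrite [RHS]ltn_neqAle andbC eq_sym.
rewrite -paths_sumS.
case: (leqP n i.+1) => [le_ni|lt_in']; last by apply: IHp => //; lia.
rewrite paths_sumS big1 ?drop_oversize ?size_xvars // => l.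
by move=> le_il; have := ltn_ord l; rewrite ltnNge (leq_trans le_ni).
Qed.

Lemma hsym_csym d : hsym n d = csym xvars d.
Proof.
rewrite -[xvars]drop0 -paths_sum_csym; apply: eq_bigl => t.
by case: (tval t) => //= x s; rewrite leq0n.
Qed.

End Variables.

(** * Ideals, and the relations between the ideals I_{n,k,r} *)

Section IdealGen.
Variables (A : comNzRingType) (G : seq A).
Local Notation I := (ideal_gen G).

Lemma ideal_gen0 : I 0.
Proof. by exists (fun=> 0); rewrite big1 // => i _; rewrite mul0r. Qed.

Lemma ideal_genD p q : I p -> I q -> I (p + q).
Proof.
move=> [c ->] [d ->]; exists (fun i => c i + d i).
by rewrite -big_split; apply: eq_bigr => i _; rewrite mulrDl.
Qed.

Lemma ideal_genM c p : I p -> I (c * p).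
Proof.
move=> [d ->]; exists (fun i => c * d i).
by rewrite mulr_sumr; apply: eq_bigr => i _; rewrite mulrA.
Qed.

Lemma ideal_genN p : I p -> I (- p).
Proof. by rewrite -mulN1r; apply: ideal_genM. Qed.

Lemma ideal_genB p q : I p -> I q -> I (p - q).
Proof. by move=> Ip Iq; apply: ideal_genD => //; apply: ideal_genN. Qed.

Lemma ideal_gen_sum (J : Type) (s : seq J) (Q : pred J) (F : J -> A) :
  (forall j, Q j -> I (F j)) -> I (\sum_(j <- s | Q j) F j).
Proof. by move=> IF; apply: big_ind => //; [apply: ideal_gen0|apply: ideal_genD].
  Qed.

Lemma mem_ideal_gen g : g \in G -> I g.
Proof.
move=> /(nthP 0)[i lti <-]; exists (fun j => (j == Ordinal lti)%:R).
rewrite (bigD1 (Ordinal lti)) //= eqxx mul1r big1 ?addr0 // => j /negbTE->.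
by rewrite mul0r.
Qed.

Lemma ideal_gen_ind (Q : A -> Prop) :
  Q 0 -> (forall p q, Q p -> Q q -> Q (p + q)) ->
  (forall c g, g \in G -> Q (c * g)) -> forall p, I p -> Q p.
Proof.
move=> Q0 QD QM _ [c ->]; apply: big_ind => // i _; apply: QM.
exact: mem_nth.
Qed.

End IdealGen.

Section Ideal.
Variable n : nat.
Local Notation P := {mpoly rat[n]}.
Local Notation X := (xvars n).

Lemma Inkr_csym k r d : (k < d <= k + n)%N -> Inkr n k r (csym X d).
Proof.
move=> dP; apply: mem_ideal_gen; rewrite mem_cat; apply/orP; left.
apply/mapP; exists (d - k)%N; first by rewrite mem_iota; lia.
by rewrite subnKC ?hsym_csym //; lia.
Qed.

Lemma Inkr_esym k r d : (r <= n)%N -> (n - r < d)%N -> Inkr n k r (esym X d).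
Proof.
move=> le_rn ltd; case: (leqP d n) => [le_dn|lt_nd]; last first.
  by rewrite esym_over ?size_xvars //; apply: ideal_gen0.
apply: mem_ideal_gen; rewrite mem_cat; apply/orP; right.
apply/mapP; exists (n - d)%N; first by rewrite mem_iota; lia.
by rewrite -mesym_esym subKn.
Qed.

(** Generators are only ever used through e_d and h_d as functions of the list
    of variables; this is the elimination principle in those terms. *)
Lemma Inkr_ind k r (Q : P -> Prop) :
  (r <= n)%N -> Q 0 -> (forall p q, Q p -> Q q -> Q (p + q)) ->
  (forall c d, (k < d <= k + n)%N -> Q (c * csym X d)) ->
  (forall c d, (n - r < d <= n)%N -> Q (c * esym X d)) ->
  forall p, Inkr n k r p -> Q p.
Proof.
move=> le_rn Q0 QD Qh Qe p; apply: ideal_gen_ind => // c g.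
rewrite mem_cat => /orP[] /mapP[i]; rewrite mem_iota => iP ->.
  by rewrite hsym_csym; apply: Qh; lia.
by rewrite mesym_esym; apply: Qe; lia.
Qed.

Lemma homog_csym (s : seq P) d :
  all (fun x => x \is 1.-homog) s -> csym s d \is d.-homog.
Proof.
elim: s d => [|x s IH] d /= => [_|/andP[hx hs]].
  by case: d => [|d]; rewrite ?dhomog1 ?dhomog0.
elim: d => [|d IHd]; first by rewrite dhomog1.
by rewrite dhomogD ?IH // -add1n dhomogM.
Qed.

Lemma homog_csym_xvars d : csym X d \is d.-homog.
Proof.
by apply: homog_csym; apply/allP => _ /mapP[i _ ->]; rewrite dhomogX;
  apply/eqP/mdeg1.
Qed.

Lemma homog_esym_xvars d : esym X d \is d.-homog.
Proof. by rewrite -mesym_esym dhomog_mesym. Qed.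

(** Multiplication by a homogeneous polynomial shifts degrees, so a homogeneous
    component of a multiple of [g] is again a multiple of [g]. *)
Lemma pihomogMr d e (c g : P) : g \is e.-homog ->
  pihomog [measure of mdeg] d (c * g) =
  (\sum_(m <- msupp c | (mdeg m + e == d)%N) c@_m *: 'X_[m]) * g.
Proof.
move=> hg; rewrite {1}[c]mpolyE !mulr_suml linear_sum /= [RHS]big_mkcond /=.
apply: eq_bigr => m _; rewrite -!scalerAl linearZ /=.
have hmg : 'X_[m] * g \is (mdeg m + e).-homog by rewrite dhomogM ?dhomogX.
case: eqP => [<-|/eqP ne]; first by rewrite pihomog_dE.
by rewrite (pihomog_ne0 ne hmg); apply: scaler0.
Qed.

Lemma Inkr_pihomog k r d p : (r <= n)%N ->
  Inkr n k r p -> Inkr n k r (pihomog [measure of mdeg] d p).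
Proof.
move=> le_rn; pose Q q := Inkr n k r (pihomog [measure of mdeg] d q).
apply: (@Inkr_ind k r Q) => //; rewrite /Q.
- by rewrite pihomog0; apply: ideal_gen0.
- by move=> q q' Iq Iq'; rewrite pihomogD; apply: ideal_genD.
- move=> c e He; rewrite (pihomogMr _ _ (homog_csym_xvars e)).
  by apply: ideal_genM; apply: Inkr_csym.
- move=> c e He; rewrite (pihomogMr _ _ (homog_esym_xvars e)).
  by apply: ideal_genM; apply: Inkr_esym => //; lia.
Qed.

(** In the relation [sum_i (-1)^i e_i h_(k + n - r - i) = 0] the terms with
    [i < n - r] contain one of h_(k+1), ..., h_(k+n-r) and those with [i > n - r]
    one of e_(n-r+1), ..., e_n or vanish. The remaining one is this product. *)
Lemma Inkr_esymM_csym k r : (r < n)%N ->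
  Inkr n k r (esym X (n - r) * csym X k).
Proof.
move=> lt_rn; have := esym_csym X (k + (n - r)).-1.
have -> : ((k + (n - r)).-1.+1 = k + (n - r))%N by lia.
have lti : (n - r < (k + (n - r)).+1)%N by lia.
rewrite (bigD1 (Ordinal lti)) //= addnK -mulrA.
move/eqP; rewrite addrC addr_eq0 => /eqP E.
have -> : esym X (n - r) * csym X k =
   (- (-1) ^+ (n - r)) * (- ((-1) ^+ (n - r) * (esym X (n - r) * csym X k))).
  by rewrite mulrNN mulrA -signr_odd -expr2 sqrr_sign mul1r.
rewrite -E; apply: ideal_genM; apply: ideal_gen_sum => i ne_i.
have {}ne_i : (i != n - r :> nat)%N by apply: contraNneq ne_i => Ei;
  apply/eqP/val_inj.
have := ltn_ord i => lt_i.
case: (ltnP (n - r) i) => [gti|lei]; last first.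
  by apply: ideal_genM; apply: Inkr_csym; lia.
rewrite mulrC; apply: ideal_genM.
by apply: ideal_genM; apply: Inkr_esym; lia.
Qed.

(** The only generator of I_{n,k,r} that need not lie in I_{n,k+1,r} is h_(k+1),
    and [e_(n-r) h_(k+1)] is in I_{n,k+1,r}. Hence multiplication by e_(n-r) induces
    a map from R_{n,k,r} to R_{n,k+1,r}, whose cokernel is R_{n,k+1,r+1}. *)
Lemma Inkr_lift k r p : (r < n)%N ->
  Inkr n k r p -> Inkr n k.+1 r (esym X (n - r) * p).
Proof.
move=> lt_rn; pose Q q := Inkr n k.+1 r (esym X (n - r) * q).
apply: (@Inkr_ind k r Q); rewrite /Q; first exact: ltnW.
- by rewrite mulr0; apply: ideal_gen0.
- by move=> q q' Iq Iq'; rewrite mulrDr; apply: ideal_genD.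
- move=> c d dP; rewrite mulrCA; apply: ideal_genM.
  case: (ltnP k.+1 d) => [lt_kd|le_dk].
    by apply: ideal_genM; apply: Inkr_csym; lia.
  have -> : d = k.+1 by lia.
  exact: Inkr_esymM_csym.
- move=> c d dP; rewrite mulrA; apply: ideal_genM.
  by apply: Inkr_esym; lia.
Qed.

Lemma Inkr_split k r p : (r < n)%N ->
  Inkr n k r.+1 p -> exists q, Inkr n k r (p - esym X (n - r) * q).
Proof.
move=> lt_rn; pose Q p := exists q, Inkr n k r (p - esym X (n - r) * q).
apply: (@Inkr_ind k r.+1 Q) => //; rewrite /Q.
- by exists 0; rewrite mulr0 subrr; apply: ideal_gen0.
- move=> p1 p2 [q1 I1] [q2 I2]; exists (q1 + q2).
  by rewrite mulrDr opprD addrACA; apply: ideal_genD.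
- move=> c d dP; exists 0; rewrite mulr0 subr0; apply: ideal_genM.
  exact: Inkr_csym.
- move=> c d dP; case: (ltnP (n - r) d) => [ltd|led].
    exists 0; rewrite mulr0 subr0; apply: ideal_genM.
    by apply: Inkr_esym => //; lia.
  exists c; have -> : d = (n - r)%N by lia.
  by rewrite mulrC subrr; apply: ideal_gen0.
Qed.

(** For [k = 0] the relation above shows that e_(n-r) itself is in the ideal,
    since h_0 = 1. *)
Lemma Inkr0_mono r p : (r < n)%N -> Inkr n 0 r.+1 p -> Inkr n 0 r p.
Proof.
move=> lt_rn /(Inkr_split lt_rn)[q Iq].
rewrite -[p](subrK (esym X (n - r) * q)); apply: ideal_genD => //.
rewrite mulrC; apply: ideal_genM.
by have := Inkr_esymM_csym 0 lt_rn; rewrite csym0 mulr1.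
Qed.

End Ideal.

(** * Polynomials in the last variables *)

Section Leads.
Variable n : nat.
Local Notation P := {mpoly rat[n]}.
Local Notation X := (xvars n).
Implicit Types (p q f : P) (u v w : 'X_{1..n}).

Definition tail_mnm (i : nat) v := [forall l : 'I_n, (l < i)%N ==> (v l == 0%N)].

Lemma tail_mnmP i v :
  reflect (forall l : 'I_n, (l < i)%N -> v l = 0%N) (tail_mnm i v).
Proof.
apply: (iffP forallP) => H l; first by move=> lt; apply/eqP; apply: implyP lt.
by apply/implyP => /H ->.
Qed.

Definition tail (i : nat) : {pred P} := fun p => all (tail_mnm i) (msupp p).

Lemma tailP i p : reflect {in msupp p, forall v, tail_mnm i v} (p \in tail i).
Proof. exact: allP. Qed.

Lemma tail_subring i : subring_closed (tail i).
Proof.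
split.
- by apply/tailP => v; rewrite msupp1 inE => /eqP->; apply/tail_mnmP => l _;
  rewrite mnm0E.
- move=> p q /tailP tp /tailP tq; apply/tailP => v /msuppB_le.
  by rewrite mem_cat => /orP[/tp|/tq].
move=> p q /tailP tp /tailP tq;
  apply/tailP => v /msuppM_le /allpairsP[[v1 v2] /= [/tp t1 /tq t2 ->]].
apply/tail_mnmP => l lt; rewrite mnmDE.
by rewrite (tail_mnmP _ _ t1) // (tail_mnmP _ _ t2).
Qed.

HB.instance Definition _ i := GRing.isSubringClosed.Build P (tail i) (tail_subring i).

Lemma tail_leq i i' p : (i <= i')%N -> p \in tail i' -> p \in tail i.
Proof.
move=> le /tailP tp; apply/tailP => v /tp /tail_mnmP tv; apply/tail_mnmP => l lt.
by apply: tv; apply: leq_trans le.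
Qed.

Lemma tail_drop i x : x \in drop i X -> x \in tail i.
Proof.
move=> /(nthP 0)[j]; rewrite size_drop size_xvars => ltj <-.
have ltij : (i + j < n)%N by lia.
rewrite nth_drop (nth_map (Ordinal ltij)) ?size_enum_ord //.
apply/tailP => v; rewrite msuppX inE => /eqP->; apply/tail_mnmP => l ltl.
rewrite mnm1E; case: eqP => // E; move: ltl; rewrite -E.
by rewrite (nth_enum_ord _ ltij); lia.
Qed.

Lemma tail_esym i d : esym (drop i X) d \in tail i.
Proof.
have : all (mem (tail i)) (drop i X) by apply/allP => x /tail_drop.
elim: (drop i X) d => [|x s IH] [|d] //= => [_|_|_|/andP[tx ts]];
  rewrite ?rpred0 ?rpred1 //.
by rewrite rpredD ?rpredM ?IH.
Qed.

(** Polynomials in the variables of index at least [i], of degree less than [N]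
    in the variable of index [i]. These are the terms that the lexicographic
    order neglects next to [x_i ^ N] times a polynomial in the later variables.
    A strict bound makes [N = 0] mean that the polynomial is zero. *)
Definition xlow (i : 'I_n) (N : nat) p :=
  {in msupp p, forall v, tail_mnm i v /\ (v i < N)%N}.

Lemma xlow0 i N : xlow i N 0.
Proof. by move=> v; rewrite msupp0. Qed.

Lemma xlowD i N p q : xlow i N p -> xlow i N q -> xlow i N (p + q).
Proof. by move=> lp lq v /msuppD_le; rewrite mem_cat => /orP[/lp|/lq]. Qed.

Lemma xlowM i N M p q : xlow i N p -> xlow i M.+1 q -> xlow i (N + M) (q * p).
Proof.
move=> lp lq v /msuppM_le /allpairsP[[v1 v2] /= [/lq[t1 lt1] /lp[t2 lt2] ->]].
split; last by rewrite mnmDE; lia.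
apply/tail_mnmP => l lt; rewrite mnmDE.
by rewrite (tail_mnmP _ _ t1) // (tail_mnmP _ _ t2).
Qed.

Lemma xlow_tail (i : 'I_n) p : p \in tail i.+1 -> xlow i 1 p.
Proof.
move=> tp v vp; have /tail_mnmP tv := tailP _ _ tp v vp.
by split; [apply/tail_mnmP => l lt; apply: tv; apply: ltnW|rewrite tv].
Qed.

Lemma xlow_leq i N M p : (N <= M)%N -> xlow i N p -> xlow i M p.
Proof. by move=> le lp v /lp[tv lt]; split=> //; apply: leq_trans le. Qed.

Lemma xlow_Xn i N : xlow i N.+1 ('X_i ^+ N).
Proof.
rewrite mpolyXn => v; rewrite msuppX inE => /eqP->; split.
  apply/tail_mnmP => l lt; rewrite mulmnE mnm1E; case: eqP => // E.
  by rewrite E ltnn in lt.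
by rewrite mulmnE mnm1E eqxx mul1n.
Qed.

Lemma xlow_X (i : 'I_n) : xlow i 2 'X_i.
Proof. by have := @xlow_Xn i 1; rewrite expr1. Qed.

Lemma xlowMtail (i : 'I_n) N p c : c \in tail i.+1 -> xlow i N p -> xlow i N (c * p).
Proof. by move=> tc lp; rewrite -[N]addn0; apply: xlowM => //; apply: xlow_tail.
  Qed.

Lemma xlow_sum i N (J : Type) (s : seq J) (Q : pred J) (F : J -> P) :
  (forall j, Q j -> xlow i N (F j)) -> xlow i N (\sum_(j <- s | Q j) F j).
Proof. by move=> lF; apply: big_ind => //; [apply: xlow0|apply: xlowD]. Qed.

Lemma xlow_prod (i : 'I_n) N (a b : 'I_N -> P) :
  (forall l, a l \in tail i.+1) -> (forall l, b l \in tail i.+1) ->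
  xlow i N (\prod_l (a l + 'X_i * b l) - 'X_i ^+ N * \prod_l b l).
Proof.
elim: N a b => [|N IH] a b ta tb.
  by rewrite !big_ord0 mulr1 subrr; apply: xlow0.
rewrite !big_ord_recl.
set p := \prod_(l < N) (_ + _); set q := \prod_(l < N) _.
have tq : q \in tail i.+1 by apply: rpred_prod => l _.
have lpq : xlow i N (p - 'X_i ^+ N * q) by apply: IH => l.
have -> : (a ord0 + 'X_i * b ord0) * p - 'X_i ^+ N.+1 * (b ord0 * q) =
  'X_i * (b ord0 * (p - 'X_i ^+ N * q)) +
  (a ord0 * (p - 'X_i ^+ N * q) + (a ord0 * q) * 'X_i ^+ N) by rewrite exprS; ring.
apply: xlowD.
  by rewrite -addn1; apply: xlowM; [apply: xlowMtail|apply: xlow_X].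
apply: xlowD; first by apply: xlowMtail => //; apply: xlow_leq lpq.
by apply: xlowMtail; [rewrite rpredM|apply: xlow_Xn].
Qed.

(** The determinant of [A + x B] is a polynomial in [x] whose top coefficient is
    [det B]. *)
Lemma xlow_det (i : 'I_n) N (A B : 'M[P]_N) :
  (forall l a, A l a \in tail i.+1) -> (forall l a, B l a \in tail i.+1) ->
  xlow i N (\det (A + 'X_i *: B) - 'X_i ^+ N * \det B).
Proof.
move=> tA tB; rewrite /determinant mulr_sumr -sumrB; apply: xlow_sum => s _.
rewrite mulrCA -mulrBr; apply: xlowMtail; first by rewrite rpred_sign.
under eq_bigr => l _ do rewrite !mxE.
exact: (@xlow_prod i N (fun l => A l (s l)) (fun l => B l (s l))).
Qed.

(** * Lexicographic leads in the ideal *)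

Definition lexmonic f u := f@_u = 1 /\ {in msupp f, forall v, v != u -> mlex_lt v u}.

Lemma lexmonic1 : lexmonic 1 0%MM.
Proof.
split; first by rewrite mcoeff1 eqxx.
by move=> v; rewrite msupp1 inE => /eqP->; rewrite eqxx.
Qed.

Lemma mlex_ltD m u v : mlex_lt u v -> mlex_lt (m + u)%MM (m + v)%MM.
Proof.
move=> [i [E lt]]; exists i; split=> [l /E|]; rewrite !mnmDE ?ltn_add2l // => ->.
by [].
Qed.

Lemma lexmonic_supp f u : lexmonic f u -> u \in msupp f.
Proof. by case=> fu _; rewrite mcoeff_msupp fu oner_eq0. Qed.

Lemma lexmonicMX m f u : lexmonic f u -> lexmonic (f * 'X_[m]) (m + u)%MM.
Proof.
move=> [fu fl]; split; first by rewrite mcoeffMX.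
move=> v; rewrite (perm_mem (msuppMX _ _)) => /mapP[w wf ->].
by rewrite eqm_add2l => /(fl w wf)/mlex_ltD; apply.
Qed.

(** The first variables decide the lexicographic order, so a lead in the later
    variables survives multiplication by [x_i ^ N] and the addition of terms of
    lower degree in [x_i]. *)
Lemma lexmonic_xlow (i : 'I_n) N f g u : f \in tail i.+1 -> lexmonic f u ->
  xlow i N (g - 'X_i ^+ N * f) -> lexmonic g (U_(i) *+ N + u)%MM.
Proof.
move=> tf lf; set h := g - _ => lh.
have -> : g = f * 'X_[U_(i) *+ N] + h by rewrite /h -mpolyXn; ring.
have [fu fl] := lexmonicMX (U_(i) *+ N) lf.
split.
  rewrite mcoeffD fu (_ : h@_ _ = 0) ?addr0 //; apply: memN_msupp_eq0.
  apply/negP => /lh[_]; rewrite mnmDE mulmnE mnm1E eqxx; lia.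
move=> v /msuppD_le; rewrite mem_cat => /orP[/fl //|/lh[/tail_mnmP tv lt] _].
exists i; split; last by rewrite mnmDE mulmnE mnm1E eqxx; lia.
move=> l ltl; rewrite tv // mnmDE mulmnE mnm1E.
rewrite (tail_mnmP _ _ (tailP _ _ tf u (lexmonic_supp lf)) l) ?leqW //.
by case: eqP => // E; rewrite E ltnn in ltl.
Qed.

Lemma tail_csym i d : csym (drop i X) d \in tail i.
Proof.
have : all (mem (tail i)) (drop i X) by apply/allP => x /tail_drop.
elim: (drop i X) d => [|x s IH] d //=; first by rewrite rpred_nat.
move=> /andP[tx ts]; elim: d => [|d IHd]; first by rewrite rpred1.
by rewrite rpredD ?rpredM ?IH.
Qed.

Lemma csym_xlow (i : 'I_n) d : xlow i d (csym (drop i X) d - 'X_i ^+ d).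
Proof.
rewrite drop_xvars; elim: d => [|d IH].
  by rewrite csym0 subrr; apply: xlow0.
rewrite csymS exprS -addrA -mulrBr; apply: xlowD.
  by apply: (@xlow_leq _ 1) => //; apply: xlow_tail; apply: tail_csym.
by rewrite -addn1; apply: xlowM => //; apply: xlow_X.
Qed.

Lemma lexmonic_csym (i : 'I_n) d : lexmonic (csym (drop i X) d) (U_(i) *+ d)%MM.
Proof.
rewrite -[X in lexmonic _ X]addm0; apply: lexmonic_xlow lexmonic1 _.
  by rewrite rpred1.
by rewrite mulr1; apply: csym_xlow.
Qed.

(** Dropping a variable [x] from h_d subtracts [x h_(d-1)], hence it costs one
    degree: of h_(k+1), ..., h_(k+n) in all variables, h_(k+i+1), ..., h_(k+n)
    remain after [i] variables have been dropped. *)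
Lemma Inkr_csym_drop k r i d : (k + i < d <= k + n)%N -> (i <= n)%N ->
  Inkr n k r (csym (drop i X) d).
Proof.
elim: i d => [|i IH] d dP le_in; first by rewrite drop0; apply: Inkr_csym; lia.
have E : drop i X = _ := drop_xvars (Ordinal le_in).
case: d dP => [|d] dP; first by lia.
have /eqP := csymS 'X_(Ordinal le_in) (drop i.+1 X) d.
rewrite -E -subr_eq => /eqP <-; apply: ideal_genB; first by apply: IH; lia.
by apply: ideal_genM; apply: IH; lia.
Qed.

(** * Leads from minors of elementary symmetric polynomials *)

(** The matrix with entries [e_(d-a)(x_i, x_(i+1), ...)], with rows indexed by
    [d] and columns by [a]; entries of negative degree vanish. Truncated
    subtraction would give them the value e_0 = 1, hence the test. *)
Definition shifted_esym i d a := if (a <= d)%N then esym (drop i X) (d - a) else 0.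

Definition esym_minor i j (d : 'I_j.+1 -> nat) : P :=
  \det (\matrix_(l, a) shifted_esym i (d l) a).

(** The ideal generated, in the ring of polynomials in the variables of index at
    least [i], by the minors with columns [0, ..., j] and with rows [d >= m].
    It replaces the ideal generated by the e_d with [d >= m] after [j] of the
    earlier variables have been eliminated. The coefficients must stay in the later
    variables in order not to disturb leads. *)
Inductive minor_ideal i m j : P -> Prop :=
| minor_ideal_nil : minor_ideal i m j 0
| minor_ideal_cons c d f : c \in tail i -> (forall l, m <= d l)%N ->
    minor_ideal i m j f -> minor_ideal i m j (c * esym_minor i (j := j) d + f).

Lemma tail_shifted_esym i d a : shifted_esym i d a \in tail i.
Proof. by rewrite /shifted_esym; case: ifP; rewrite ?rpred0 ?tail_esym. Qed.

Lemma tail_det i N (A : 'M[P]_N) : (forall l a, A l a \in tail i) -> \det A \in tail i.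
Proof.
move=> tA; apply: rpred_sum => s _; apply: rpredM; first by rewrite rpred_sign.
by apply: rpred_prod.
Qed.

Lemma tail_minor_ideal i m j f : minor_ideal i m j f -> f \in tail i.
Proof.
elim=> [|c d g tc _ _ tg]; first by rewrite rpred0.
rewrite rpredD ?rpredM // tail_det // => l a.
by rewrite mxE tail_shifted_esym.
Qed.

Lemma minor_idealD i m j f g :
  minor_ideal i m j f -> minor_ideal i m j g -> minor_ideal i m j (f + g).
Proof.
elim=> [|c d h tc dP _ IH] mg; first by rewrite add0r.
by rewrite -addrA; apply: minor_ideal_cons => //; apply: IH.
Qed.

Lemma minor_idealM i m j c f : c \in tail i ->
  minor_ideal i m j f -> minor_ideal i m j (c * f).
Proof.
move=> tc; elim=> [|c' d h tc' dP _ IH]; first by rewrite mulr0; constructor.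
by rewrite mulrDr mulrA; constructor => //; rewrite rpredM.
Qed.

Lemma mem_minor_ideal i m j (d : 'I_j.+1 -> nat) : (forall l, m <= d l)%N ->
  minor_ideal i m j (esym_minor i d).
Proof.
move=> dP; rewrite -[esym_minor i d]mul1r -[_ * _]addr0.
by constructor => //; [rewrite rpred1|constructor].
Qed.

Lemma shifted_esymS (i : 'I_n) d a :
  shifted_esym i d.+1 a =
    shifted_esym i.+1 d.+1 a + 'X_i * shifted_esym i.+1 d a.
Proof.
rewrite /shifted_esym drop_xvars; case: (ltngtP a d.+1) => [lt|gt|->].
- by rewrite -ltnS lt subSn // esymS.
- by rewrite leqNgt ltnW // mulr0 addr0.
by rewrite subnn ltnn !esym0 mulr0 addr0.
Qed.

Lemma shifted_esymC (i : 'I_n) d a :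
  shifted_esym i d a =
    shifted_esym i.+1 d a + 'X_i * shifted_esym i.+1 d a.+1.
Proof.
rewrite /shifted_esym drop_xvars; case: (ltngtP a d) => [lt|gt|->].
- by rewrite -{1 2}(subnSK lt) esymS.
- by rewrite mulr0 addr0.
by rewrite subnn !esym0 mulr0 addr0.
Qed.

(** A column operation of determinant one adds [x_i] to the variables of the
    entries in all columns but the last. In the expansion along the last column
    the cofactors are then minors of one size less that include [x_i]. *)
Lemma minor_ideal_nonskip (i : 'I_n) m j f :
  minor_ideal i.+1 m j.+1 f -> minor_ideal i m j f.
Proof.
elim=> [|c d g tc dP _ mg]; first by constructor.
apply: minor_idealD => //; apply: minor_idealM; first by apply: tail_leq tc.
pose A := \matrix_(l < j.+2, a < j.+2) shifted_esym i.+1 (d l) a.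
(* [A *m B] adds to each column [x_i] times the next one. *)
pose B : 'M[P]_j.+2 := \matrix_(a, b) ((a == b)%:R + 'X_i *+ (a == b.+1 :> nat)).
have detB : \det B = 1.
  rewrite det_trig; last first.
    apply/is_trig_mxP => a b lt_ab; rewrite mxE.
    case: eqP => [E|_]; first by rewrite E ltnn in lt_ab.
    by case: eqP => [E|_]; [rewrite E in lt_ab; lia|rewrite addr0].
  by rewrite big1 // => a _; rewrite mxE eqxx (ltn_eqF (ltnSn a)) addr0.
have AB l b : (A *m B) l b = shifted_esym i.+1 (d l) b +
    'X_i *+ (b != ord_max) * shifted_esym i.+1 (d l) b.+1.
  rewrite mxE (bigD1 b) //= !mxE eqxx (ltn_eqF (ltnSn b)) addr0 mulr1.
  congr (_ + _); case: (eqVneq b ord_max) => [Eb|ne_b].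
    rewrite mul0r big1 // => a ne_ab; rewrite !mxE (negbTE ne_ab) add0r.
    case: eqP => [E|_]; last by rewrite mulr0.
    by have := ltn_ord a; rewrite E Eb /= ltnn.
  have ltb : (b.+1 < j.+2)%N by rewrite ltnS ltn_neqAle ne_b -ltnS ltn_ord.
  rewrite (bigD1 (Ordinal ltb)) /=; last by apply/eqP => /(congr1 val) /=; lia.
  rewrite !mxE /= eqxx (_ : Ordinal ltb == b = false) ?add0r; last first.
    by apply/eqP => /(congr1 val) /=; lia.
  rewrite big1 ?addr0 1?mulrC // => a /andP[ne_ab ne_a];
    rewrite !mxE (negbTE ne_ab) add0r.
  case: eqP => [E|_]; last by rewrite mulr0.
  by case/eqP: ne_a; apply: val_inj.
have -> : esym_minor i.+1 d = \det (A *m B) by rewrite det_mulmx detB mulr1.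
rewrite (expand_det_col _ ord_max).
elim/big_ind: _ => [||l _]; [by constructor|by move=> *; apply: minor_idealD|].
have tAB : (A *m B) l ord_max \in tail i.
  by rewrite AB eqxx mul0r addr0; apply: (tail_leq (leqnSn i));
    apply: tail_shifted_esym.
apply: minor_idealM => //; apply: minor_idealM; first by rewrite rpred_sign.
have -> : row' l (col' ord_max (A *m B)) =
    \matrix_(l', a) shifted_esym i (d (lift l l')) a.
  apply/matrixP => l' a; rewrite mxE [LHS]mxE AB [RHS]mxE shifted_esymC.
  by rewrite lift_max (eq_sym _ ord_max) neq_lift.
by apply: mem_minor_ideal => l'; apply: dP.
Qed.

(** Raising all row indices by one turns the minor in the variables after [x_i]
    into the coefficient of [x_i ^ (j + 1)] in the minor that includes [x_i]. *)
Lemma minor_ideal_skip (i : 'I_n) m j f :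
  minor_ideal i.+1 m j f ->
  exists2 g, minor_ideal i m.+1 j g & xlow i j.+1 (g - 'X_i ^+ j.+1 * f).
Proof.
elim=> [|c d h tc dP _ [g mg lg]].
  by exists 0; [constructor|rewrite mulr0 subrr; apply: xlow0].
exists (c * esym_minor i (fun l => (d l).+1) + g).
  by constructor => //; apply: tail_leq tc.
rewrite mulrDr opprD addrACA; apply: xlowD => //.
rewrite mulrCA -mulrBr; apply: xlowMtail => //.
rewrite /esym_minor.
have -> : \matrix_(l < j.+1, a < j.+1) shifted_esym i (d l).+1 a =
    (\matrix_(l, a) shifted_esym i.+1 (d l).+1 a) +
    'X_i *: (\matrix_(l, a) shifted_esym i.+1 (d l) a).
  by apply/matrixP => l a; rewrite !mxE shifted_esymS.
by apply: xlow_det => l a; rewrite mxE tail_shifted_esym.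
Qed.

(** For [m = 0] no rows are excluded, and the rows [0, ..., j] form a unitriangular
    matrix, so the ideal is the unit ideal. *)
Lemma minor_ideal1 i j : minor_ideal i 0 j 1.
Proof.
suff <- : esym_minor i (fun l : 'I_j.+1 => l) = 1 by apply: mem_minor_ideal.
rewrite /esym_minor det_trig => [|].
  by rewrite big1 // => a _; rewrite mxE /shifted_esym leqnn subnn esym0.
by apply/is_trig_mxP => a b lt; rewrite mxE /shifted_esym leqNgt lt.
Qed.

(** The part of the skip monomial supported on indices at least [i], when [j]
    indices smaller than [i] are outside [S]. *)
Definition skip_exp (S : pred nat) i j : 'X_{1..n} :=
  [multinom (if (i <= l)%N && S l
             then (j + \sum_(i <= t < l) ~~ S t).+1 else 0%N) | l < n].

(** The indices are read from the last to the first. An index outside [S] keeps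
    the polynomial and lowers [j], an index [i] in [S] multiplies the lead by
    [x_i ^ (j + 1)] and raises the least admissible row. *)
Lemma skip_lead (S : pred nat) i j : (i <= n)%N ->
  exists2 f, minor_ideal i (\sum_(i <= t < n) S t) j f & lexmonic f (skip_exp S i j).
Proof.
have [e Ee] : exists e, e = (n - i)%N by exists (n - i)%N.
elim: e i j Ee => [|e IH] i j Ee le_in.
  have -> : i = n by lia.
  exists 1; first by rewrite big_geq //; apply: minor_ideal1.
  rewrite (_ : skip_exp S n j = 0%MM); first exact: lexmonic1.
  by apply/mnmP => l; rewrite mnmE mnm0E leqNgt ltn_ord.
have lt_in : (i < n)%N by lia.
rewrite big_ltn //; case: (boolP (S i)) => Si.
  have [f mf lf] : exists2 f, _ & _ := IH i.+1 j ltac:(lia) ltac:(lia).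
  have [g mg lg] := minor_ideal_skip (i := Ordinal lt_in) mf.
  exists g => //.
  rewrite (_ : skip_exp S i j = U_(Ordinal lt_in) *+ j.+1 + skip_exp S i.+1 j)%MM.
    have tf := tail_minor_ideal mf.
    exact: (@lexmonic_xlow (Ordinal lt_in) j.+1 f g _ tf lf lg).
  apply/mnmP => l; rewrite mnmDE mulmnE mnm1E !mnmE.
  rewrite -(inj_eq val_inj) /=; case: (ltngtP i l) => [lt_il|_|Eil] /=; last first.
  - by rewrite -Eil Si big_geq // addn0 mul1n addn0.
  - by [].
  by case: ifP => // _; rewrite big_ltn // Si.
have [f mf lf] : exists2 f, _ & _ := IH i.+1 j.+1 ltac:(lia) ltac:(lia).
exists f; first exact: (@minor_ideal_nonskip (Ordinal lt_in)).
rewrite (_ : skip_exp S i j = skip_exp S i.+1 j.+1) //.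
apply/mnmP => l; rewrite !mnmE; case: (ltngtP i l) => [lt_il|_|Eil] //=.
  by rewrite [in LHS]big_ltn // Si addSnnS.
by rewrite -Eil (negbTE Si).
Qed.

(** For [i = j = 0] the minors are the single entries e_d. *)
Lemma minor_ideal_Inkr k r f : (r <= n)%N ->
  minor_ideal 0 (n - r).+1 0 f -> Inkr n k r f.
Proof.
move=> le_rn; elim=> [|c d g _ dP _ Ig]; first exact: ideal_gen0.
apply: ideal_genD => //; apply: ideal_genM.
rewrite /esym_minor det_mx11 mxE /shifted_esym /= subn0 drop0.
exact: Inkr_esym (dP ord0).
Qed.

Lemma skip_expE (S : {set 'I_n}) :
  skip_exp (fun t => t \in [seq val i | i <- enum S]) 0 0 = skip_monomial S.
Proof.
have inS (i : 'I_n) : (val i \in [seq val i | i <- enum S]) = (i \in S).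
  by rewrite mem_map ?mem_enum //; apply: val_inj.
apply/mnmP => l; rewrite !mnmE /= inS; case: ifP => // lS.
(* Below [l], the indices in [S] and those outside [S] are [l] in total. *)
have -> : #|[set j in S | (j < l)%N]| =
    (\sum_(0 <= t < l) (t \in [seq val i | i <- enum S]))%N.
  rewrite -sum1_card big_mkcond /= big_mkord.
  rewrite (big_ord_widen n (fun t => nat_of_bool (t \in _))); last by rewrite ltnW.
  rewrite [RHS]big_mkcond /=; apply: eq_bigr => i _.
  by rewrite !inE inS; case: (i \in S); case: (i < l)%N.
rewrite add0n; apply/eqP; rewrite eq_sym subSn; last first.
  rewrite -[X in (_ <= X)%N]subn0 -[X in (_ <= X)%N]muln1 -sum_nat_const_nat.
  by apply: leq_sum => t _; case: (_ \in _).
rewrite eqSS -(eqn_add2r (\sum_(0 <= t < l) (t \in [seq val i | i <- enum S]))%N).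
rewrite subnK; last first.
  rewrite -[X in (_ <= X)%N]subn0 -[X in (_ <= X)%N]muln1 -sum_nat_const_nat.
  by apply: leq_sum => t _; case: (_ \in _).
rewrite -big_split /= -[X in X == _]subn0 -[X in X == _]muln1 -sum_nat_const_nat.
by apply/eqP; apply: eq_bigr => t _; case: (_ \in _).
Qed.

Lemma skip_monomial_lead k r (S : {set 'I_n}) : (r <= n)%N -> #|S| = (n - r + 1)%N ->
  exists2 f, Inkr n k r f & lexmonic f (skip_monomial S).
Proof.
move=> le_rn cS.
have [f mf lf] := skip_lead (fun t => t \in [seq val i | i <- enum S]) 0 (leq0n n).
exists f; last by rewrite -skip_expE.
apply: minor_ideal_Inkr => //.
suff <- : (\sum_(0 <= t < n) (t \in [seq val i | i <- enum S]))%N = (n - r).+1 by [].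
rewrite -addn1 -cS -sum1_card [RHS]big_mkcond /= big_mkord; apply: eq_bigr => i _.
by rewrite mem_map ?mem_enum; [case: (i \in S)|apply: val_inj].
Qed.

End Leads.

(** * Reduction to good monomials *)

Section Spanning.
Variables n k r : nat.
Hypothesis le_rn : (r <= n)%N.
Local Notation P := {mpoly rat[n]}.
Implicit Types (p q f : P) (u v w : 'X_{1..n}).

Definition goodb (k r : nat) u :=
  [forall S : {set 'I_n}, (#|S| == n - r + 1)%N ==> ~~ (skip_monomial S <= u)%MM]
  && [forall i : 'I_n, ~~ (U_(i) *+ (k + i.+1) <= u)%MM].

Lemma goodP k' r' u : reflect (good_monomial n k' r' u) (goodb k' r' u).
Proof.
apply: (iffP andP) => [[/forallP gS /forallP gi]|[gS gi]]; split=> //.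
- by move=> S /eqP cS; apply: implyP cS.
- by apply/forallP => S; apply/implyP => /eqP; apply: gS.
- exact/forallP.
Qed.

Local Notation I := (Inkr n k r).

Lemma bad_lexmonic u : ~~ goodb k r u -> exists2 f, I f & lexmonic f u.
Proof.
move=> bad; suff [f [w [If lf le_wu]]] : exists f w, [/\ I f, lexmonic f w & (w <= u)%MM].
  exists (f * 'X_[u - w]); first by rewrite mulrC; apply: ideal_genM.
  by rewrite -[X in lexmonic _ X](submK le_wu); apply: lexmonicMX.
move: bad; rewrite negb_and !negb_forall => /orP[/existsP[S]|/existsP[i]].
  rewrite negb_imply negbK => /andP[/eqP cS le_Su].
  have [f If lf] := skip_monomial_lead k le_rn cS.
  by exists f, (skip_monomial S).
rewrite negbK => le_iu; exists (csym (drop i (xvars n)) (k + i.+1)).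
exists (U_(i) *+ (k + i.+1))%MM.
split=> //; last exact: lexmonic_csym.
by apply: Inkr_csym_drop; have := ltn_ord i; lia.
Qed.

Lemma mcoeff_pihomog d p u :
  (pihomog [measure of mdeg] d p)@_u = if mdeg u == d then p@_u else 0.
Proof.
rewrite pihomogE raddf_sum /= big_mkcond /=; case: eqP => [du|/eqP ne].
  rewrite [p in RHS]mpolyE raddf_sum /=; apply: eq_bigr => m _.
  rewrite mcoeffZ mcoeffX; case: (eqVneq m u) => [->|_]; first by rewrite du eqxx.
  by rewrite mulr0; case: ifP.
rewrite big1 // => m _; rewrite mcoeffZ mcoeffX; case: (eqVneq m u) => [->|_].
  by rewrite (negbTE ne).
by rewrite mulr0; case: ifP.
Qed.

Lemma mlex_lt_ltmc u v : mdeg u = mdeg v -> mlex_lt u v <-> (u < v)%O.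
Proof.
move=> E; split=> [[i [e lt]]|]; first by apply/ltmcP => //; exists i.
by move/(ltmcP E) => [i e lt]; exists i.
Qed.

(** The ideal is homogeneous, so the component of [f] in the degree of its lead
    is in the ideal. Among monomials of one degree the lexicographic order is
    the canonical order on multinomials, which is well founded. *)
Lemma lexlead_homog f u : I f -> f@_u != 0 ->
  {in msupp f, forall v, v != u -> mlex_lt v u} ->
  exists g, [/\ I g, g@_u = f@_u &
    {in msupp g, forall v, mdeg v = mdeg u /\ (v != u -> (v < u)%O)}].
Proof.
move=> If fu fl; exists (pihomog [measure of mdeg] (mdeg u) f); split.
- exact: Inkr_pihomog.
- by rewrite mcoeff_pihomog eqxx.
move=> v; rewrite mcoeff_msupp mcoeff_pihomog;
  case: (eqVneq (mdeg v) (mdeg u)) => [E|]; last by rewrite eqxx.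
rewrite -mcoeff_msupp => vf; split=> // ne.
by apply/mlex_lt_ltmc => //; apply: fl.
Qed.

Definition reduced_to u q :=
  {in msupp q, forall v, [/\ goodb k r v, mdeg v = mdeg u & (v <= u)%O]}.

Lemma reduce_monomial u : exists2 q, I ('X_[u] - q) & reduced_to u q.
Proof.
elim/(@ltmwf n): u => u IH; case: (boolP (goodb k r u)) => [gu|bu].
  exists 'X_[u]; first by rewrite subrr; apply: ideal_gen0.
  by move=> v; rewrite msuppX inE => /eqP->; split.
have [f If [fu fl]] := bad_lexmonic bu.
have [|g [Ig gu gl]] := lexlead_homog If _ fl; first by rewrite fu oner_eq0.
rewrite fu in gu.
have {gl} gl : {in msupp (g - 'X_[u]), forall v, mdeg v = mdeg u /\ (v < u)%O}.
  move=> v; case: (eqVneq v u) => [->|ne].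
    by rewrite mcoeff_msupp mcoeffB gu mcoeffX eqxx subrr eqxx.
  rewrite mcoeff_msupp mcoeffB mcoeffX (eq_sym _ v) (negbTE ne) subr0 -mcoeff_msupp.
  by move=> /gl[-> /(_ ne)].
set h := g - _ in gl.
suff [q Iq rq] : exists2 q, I (h - q) & reduced_to u q.
  exists (- q); last by move=> v; rewrite (perm_mem (msuppN _)); apply: rq.
  rewrite (_ : _ - _ = g - (h - q)); first exact: ideal_genB.
  by rewrite /h; ring.
rewrite [h]mpolyE big_seq.
elim/big_ind: _ => [|p1 p2 [q1 I1 r1] [q2 I2 r2]|v vh].
- exists 0; first by rewrite subrr; apply: ideal_gen0.
  by move=> v; rewrite msupp0.
- exists (q1 + q2); first by rewrite opprD addrACA; apply: ideal_genD.
  by move=> v /msuppD_le; rewrite mem_cat => /orP[/r1|/r2].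
have [dv lt_vu] := gl v vh; have [q Iq rq] := IH v lt_vu.
exists (h@_v *: q); first by rewrite -scalerBr -mul_mpolyC; apply: ideal_genM.
move=> w /msuppZ_le /rq[gw dw lew]; split=> //; first by rewrite dw.
exact: le_trans lew (ltW lt_vu).
Qed.

Lemma reduce p : exists2 q, I (p - q) &
  {in msupp q, forall v, goodb k r v /\
     exists2 u, u \in msupp p & mdeg v = mdeg u /\ (v <= u)%O}.
Proof.
rewrite {1}[p]mpolyE big_seq.
elim/big_ind: _ => [|p1 p2 [q1 I1 r1] [q2 I2 r2]|u up].
- exists 0; first by rewrite subrr; apply: ideal_gen0.
  by move=> v; rewrite msupp0.
- exists (q1 + q2); first by rewrite opprD addrACA; apply: ideal_genD.
  by move=> v /msuppD_le; rewrite mem_cat => /orP[/r1|/r2].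
have [q Iq rq] := reduce_monomial u.
exists (p@_u *: q); first by rewrite -scalerBr -mul_mpolyC; apply: ideal_genM.
by move=> w /msuppZ_le /rq[gw dw lew]; split=> //; exists u.
Qed.

Lemma reduce_homog d p : p \is d.-homog -> exists2 q, I (p - q) &
  {in msupp q, forall v, goodb k r v /\ mdeg v = d}.
Proof.
move=> /dhomogP hp; have [q Iq rq] := reduce p;
  exists q => // v /rq[gv [u up [-> _]]].
by split=> //; apply: hp.
Qed.

Lemma standard_good u : standard_monomial I u -> goodb k r u.
Proof.
move=> su; apply: contraT => bu.
have [f If [fu fl]] := bad_lexmonic bu.
have fu0 : f@_u != 0 by rewrite fu oner_eq0.
have f0 : f != 0 by apply: contraNneq fu0 => ->; rewrite mcoeff0.
by have := su f u If f0 (conj _ fl); rewrite lepm_refl mcoeff_msupp; apply.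
Qed.

Lemma good_divisor u v : (u <= v)%MM -> goodb k r v -> goodb k r u.
Proof.
move=> le_uv /andP[/forallP gS /forallP gi]; apply/andP; split; apply/forallP.
  move=> S; apply/implyP => cS; apply: contra (implyP (gS S) cS) => le_Su.
  exact: lepm_trans le_uv.
by move=> i; apply: contra (gi i) => le_iu; apply: lepm_trans le_uv.
Qed.

(** Linear independence of the good monomials modulo the ideal. *)
Definition good_free :=
  forall p, {in msupp p, forall v, goodb k r v} -> I p -> p = 0.

(** If a good monomial were the lead of an element of the ideal, reducing the
    lower terms of that element would give a nonzero element supported on good
    monomials. *)
Lemma good_standard u : good_free -> goodb k r u -> standard_monomial I u.
Proof.
move=> free gu f w If f0 [wf fl]; apply/negP => le_wu.
have gw := good_divisor le_wu gu.
rewrite mcoeff_msupp in wf.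
have [g [Ig gw0 gl]] := lexlead_homog If wf fl.
have [q Iq rq] := reduce (g - g@_w *: 'X_[w]).
suff E : g@_w *: 'X_[w] + q = 0.
  have qw : q@_w = 0.
    apply: memN_msupp_eq0; apply/negP => /rq[_ [v]].
    case: (eqVneq v w) => [->|ne].
      by rewrite mcoeff_msupp mcoeffB mcoeffZ mcoeffX eqxx mulr1 subrr eqxx.
    rewrite mcoeff_msupp mcoeffB mcoeffZ mcoeffX (eq_sym _ v) (negbTE ne).
    rewrite mulr0 subr0 -mcoeff_msupp.
    by move=> /gl[_ /(_ ne) lt] [_ /(lt_le_trans lt)]; rewrite ltxx.
  move/(congr1 (mcoeff w)): E;
    rewrite mcoeffD mcoeffZ mcoeffX eqxx mulr1 qw addr0 mcoeff0 gw0.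
  by move/eqP; rewrite (negbTE wf).
apply: free.
  move=> v /msuppD_le; rewrite mem_cat => /orP[/msuppZ_le|/rq[] //].
  by rewrite msuppX inE => /eqP->.
rewrite (_ : _ + q = g - (g - g@_w *: 'X_[w] - q)); first exact: ideal_genB.
by rewrite !opprD !opprK !addrA subrr add0r.
Qed.

End Spanning.

Lemma lemU n (i : 'I_n) a (v : 'X_{1..n}) : (U_(i) *+ a <= v)%MM = (a <= v i)%N.
Proof.
apply/mnm_lepP/idP => [/(_ i)|le l]; rewrite mulmnE mnm1E;
  first by rewrite eqxx mul1n.
by case: eqP => [<-|_] //; rewrite mul1n.
Qed.

(** * Independence of the good monomials for r = 0 *)

Section NormalForm.
Variables n k : nat.
Local Notation P := {mpoly rat[n]}.
Local Notation X := (xvars n).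
Implicit Types (p q f : P) (u v w : 'X_{1..n}) (i : 'I_n).

(** The same polynomial, seen as a polynomial in the variable of index [i] over
    the ring of all variables. Keeping [x_i] among the coefficients avoids a
    change of ring; in the image it does not occur there. *)
Definition uni (i : 'I_n) : P -> {poly P} :=
  mmap (polyC \o @mpolyC n rat) (fun l => if l == i then 'X else ('X_l)%:P).

HB.instance Definition _ i := GRing.RMorphism.on (uni i).

Lemma uniX i m : uni i 'X_[m] = ('X_[m - U_(i) *+ m i])%:P * 'X^(m i).
Proof.
rewrite /uni mmapX /mmap1 (bigD1 i) //= eqxx mulrC; congr (_ * _).
rewrite mpolyXE_id rmorph_prod [RHS](bigD1 i) //= mnmBE mulmnE mnm1E eqxx mul1n.
rewrite subnn expr0 mul1r; apply: eq_bigr => l ne_li; rewrite (negbTE ne_li).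
by rewrite mnmBE mulmnE mnm1E eq_sym (negbTE ne_li) mul0n subn0 rmorphXn.
Qed.

Lemma uniE i p :
  uni i p = \sum_(m <- msupp p) (p@_m *: 'X_[m - U_(i) *+ m i])%:P * 'X^(m i).
Proof.
rewrite [p in LHS]mpolyE rmorph_sum; apply: eq_bigr => m _ /=.
by rewrite -!mul_mpolyC !rmorphM /= uniX /uni mmapC /= mulrA.
Qed.

Lemma horner_uni i p : (uni i p).['X_i] = p.
Proof.
rewrite uniE horner_sum [RHS]mpolyE; apply: eq_bigr => m _.
rewrite hornerM hornerC hornerXn -scalerAl mpolyXn -mpolyXD submK //.
by rewrite lemU.
Qed.

Lemma size_uni i N p : {in msupp p, forall v, (v i < N)%N} -> (size (uni i p) <= N)%N.
Proof.
move=> ltN; rewrite uniE big_seq; apply: (leq_trans (size_sum _ _ _)).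
apply/bigmax_leqP_seq => m mp _; apply: leq_trans (ltN m mp).
rewrite mul_polyC (leq_trans (size_scale_leq _ _)) //.
by rewrite size_polyXn.
Qed.

Lemma uni_tail i p : p \in tail i.+1 -> uni i p = p%:P.
Proof.
move=> /tailP tp; rewrite uniE [p in RHS]mpolyE rmorph_sum big_seq [RHS]big_seq.
apply: eq_bigr => m mp; have /tail_mnmP/(_ i (ltnSn i)) -> := tp m mp.
by rewrite mulm0n subm0 mulr1.
Qed.

Lemma uni_Xi i : uni i 'X_i = 'X.
Proof.
by rewrite uniX mnm1E eqxx mulm1n expr1 -{1}[U_(i)%MM]add0m addmK mpolyX0 mul1r.
  Qed.

Lemma uni_csym i d : uni i (csym (drop i X) d) \is monic /\
  size (uni i (csym (drop i X) d)) = d.+1.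
Proof.
rewrite drop_xvars; elim: d => [|d [mon_d size_d]].
  by rewrite csym0 rmorph1 size_poly1 monic1.
rewrite csymS rmorphD rmorphM /= uni_Xi uni_tail ?tail_csym // addrC mulrC.
set g := uni i _ in mon_d size_d *.
have ng : g != 0 by rewrite -size_poly_eq0 size_d.
have lt : (size (csym (drop i.+1 X) d.+1)%:P < size (g * 'X)%R)%N.
  by rewrite size_mulX // size_d; apply: leq_ltn_trans (size_polyC_leq1 _) _.
by rewrite monicE lead_coefDl // lead_coefMX -monicE size_polyDl // size_mulX // size_d.
Qed.

Let g (i : 'I_n) := csym (drop i X) (k + i).+1.

(** The remainder in the division, with respect to the variable of index [i], by
    h_(k+i+1)(x_i, ..., x_(n-1)), which is monic in [x_i]. *)
Definition divrem i p := (Pdiv.Ring.rmodp (uni i p) (uni i (g i))).['X_i].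

Let mon_g i : uni i (g i) \is monic. Proof. by case: (uni_csym i (k + i).+1). Qed.

Lemma divremD i p q : divrem i (p + q) = divrem i p + divrem i q.
Proof. by rewrite /divrem rmorphD Pdiv.RingMonic.rmodpD // hornerD. Qed.

Lemma divrem0 i : divrem i 0 = 0.
Proof. by rewrite /divrem rmorph0 Pdiv.Ring.rmod0p; apply: horner0. Qed.

Lemma divremMg i c : divrem i (c * g i) = 0.
Proof. by rewrite /divrem rmorphM (Pdiv.RingMonic.rmodp_mull (mon_g i));
  apply: horner0. Qed.

Lemma divrem_tail i c p : c \in tail i.+1 -> divrem i (p * c) = divrem i p * c.
Proof.
move=> tc; rewrite /divrem rmorphM /= (uni_tail tc) mulrC mul_polyC.
by rewrite Pdiv.RingMonic.rmodpZ // hornerZ mulrC.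
Qed.

Lemma divrem_small i p :
  {in msupp p, forall v, (v i < k + i.+1)%N} -> divrem i p = p.
Proof.
move=> ltp; rewrite /divrem Pdiv.Ring.rmodp_small ?horner_uni //.
apply: (leq_ltn_trans (size_uni ltp)).
by rewrite (uni_csym i _).2 addnS.
Qed.

(** Divisions by all these polynomials, the first variable first. Division with
    respect to [x_i] commutes with the multiplication by the later divisors,
    because they do not contain [x_i]; hence a multiple of a divisor is still one
    when the turn of that divisor comes. *)
Definition nform p := foldl (fun q i => divrem i q) p (enum 'I_n).

Lemma nformD p q : nform (p + q) = nform p + nform q.
Proof.
by rewrite /nform; elim: (enum _) p q => //= i s IH p q; rewrite divremD IH.
Qed.

Lemma nform0 : nform 0 = 0.
Proof. by rewrite /nform; elim: (enum _) => //= i s IH; rewrite divrem0. Qed.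

Lemma nform_gen i c : nform (c * g i) = 0.
Proof.
rewrite /nform; have: sorted ltn (map val (enum 'I_n)).
  by rewrite val_enum_ord iota_ltn_sorted.
have: i \in enum 'I_n by rewrite mem_enum.
elim: (enum 'I_n) c => //= j s IH c; rewrite inE => /orP[/eqP <- _|is_ js].
  by rewrite divremMg; elim: s {IH} => //= l s IH; rewrite divrem0.
rewrite divrem_tail; first by apply: IH => //; apply: path_sorted js.
have ltji : (j < i)%N.
  apply: (allP (order_path_min ltn_trans js)); exact: map_f.
exact: tail_leq ltji (tail_csym _ _ _).
Qed.

(** The recursion for h_d, read downwards in [i], writes every h_d of large degree
    as a combination of the divisors. *)
Lemma nform_csym (i : nat) c d : (i <= n)%N -> (k + i < d)%N ->
  nform (c * csym (drop i X) d) = 0.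
Proof.
have [e Ee] : exists e, e = (n - i)%N by exists (n - i)%N.
elim: e i Ee c d => [|e IH] i Ee c d le_in.
  rewrite drop_oversize ?size_xvars; last by lia.
  by case: d => // d _ /=; rewrite mulr0 nform0.
have lt_in : (i < n)%N by lia.
have E : drop i X = _ := drop_xvars (Ordinal lt_in).
elim: d c => // d IHd c lt_kd; case: (ltngtP (k + i) d) => [lt|gt|Ed].
- by rewrite E csymS -E mulrDr nformD mulrA IHd // addr0; apply: IH => /=; lia.
- by lia.
by rewrite -Ed; apply: (@nform_gen (Ordinal lt_in)).
Qed.

Lemma nform_Inkr p : Inkr n k 0 p -> nform p = 0.
Proof.
apply: (@Inkr_ind n k 0 (fun p => nform p = 0)) => //.
- exact: nform0.
- by move=> p1 p2 E1 E2; rewrite nformD E1 E2 addr0.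
- move=> c d dP; rewrite -[xvars n]drop0; apply: nform_csym; lia.
by move=> c d; lia.
Qed.

Lemma nform_small p :
  {in msupp p, forall v i, (v i < k + i.+1)%N} -> nform p = p.
Proof.
move=> sp; rewrite /nform; elim: (enum _) => //= i s IH.
by rewrite divrem_small // => v vp; apply: sp.
Qed.

End NormalForm.

Lemma good_free0 n k : good_free n k 0.
Proof.
move=> p gp /nform_Inkr <-; rewrite nform_small // => v vp i.
by have /andP[_ /forallP/(_ i)] := gp v vp; rewrite lemU -ltnNge.
Qed.

(** * The q-analogues *)

Lemma qintS m : qint m.+1 = qint m + 'X^m.
Proof. by rewrite /qint big_ord_recr. Qed.

Lemma qint0 : qint 0 = 0. Proof. by rewrite /qint big_ord0. Qed.

Lemma qintD a b : qint (a + b) = qint a + 'X^a * qint b.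
Proof.
elim: b => [|b IH]; first by rewrite addn0 qint0 mulr0 addr0.
by rewrite addnS !qintS IH mulrDr addrA -exprD.
Qed.

Lemma qint_neq0 m : qint m.+1 != 0.
Proof.
apply/eqP => /(congr1 (fun p : {poly rat} => p`_m))/eqP.
rewrite qintS coefD coefXn eqxx coef0 /qint coef_sum big1 ?add0r ?oner_eq0 // => i _.
by rewrite coefXn gtn_eqF.
Qed.

Lemma qfact0 : qfact 0 = 1. Proof. by rewrite /qfact big_geq. Qed.

Lemma qfactS m : qfact m.+1 = qfact m * qint m.+1.
Proof. by rewrite /qfact big_nat_recr. Qed.

Lemma qfact_neq0 m : qfact m != 0.
Proof.
elim: m => [|m IH]; first by rewrite qfact0 oner_eq0.
by rewrite qfactS mulf_neq0 // qint_neq0.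
Qed.

(** The quotients satisfy the q-Pascal rule
    [Q(a+1,b+1) = Q(a,b+1) + q^(a+1) Q(a+1,b)]. *)
Lemma qfact_dvd a b : exists Q, qfact (a + b) = Q * (qfact a * qfact b).
Proof.
have [e] := ubnP (a + b); elim: e a b => // e IH [|a] [|b] lt.
- by exists 1; rewrite add0n qfact0 !mul1r.
- by exists 1; rewrite add0n qfact0 !mul1r.
- by exists 1; rewrite addn0 qfact0 !mul1r mulr1.
have [Q1 E1] := IH a b.+1 ltac:(lia); have [Q2 E2] := IH a.+1 b ltac:(lia).
exists (Q1 + 'X^(a.+1) * Q2).
rewrite addnS qfactS -addnS qintD mulrDr addSn -addnS.
rewrite {1}E1 mulrDl; congr (_ + _); first by rewrite [qfact a.+1]qfactS; ring.
by rewrite -addSnnS E2 [qfact b.+1]qfactS; ring.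
Qed.

Lemma qbinomE a b : qbinom (a + b) a * (qfact a * qfact b) = qfact (a + b).
Proof.
have [Q E] := qfact_dvd a b; rewrite /qbinom addKn E mulpK //.
by rewrite mulf_neq0 ?qfact_neq0.
Qed.

(** * Good exponents, read greedily *)

(** The size of the set built by reading exponents from left to right and
    selecting [i] whenever the exponent there allows it, that is, exceeds the
    number of indices before [i] that were not selected. *)
Fixpoint nskips (a : nat -> nat) i :=
  if i is i'.+1 then (nskips a i' + (i' - nskips a i' < a i'))%N else 0%N.

Lemma nskips_leq a i : (nskips a i <= i)%N.
Proof. by elim: i => //= i IH; case: (_ < _)%N; lia. Qed.

Lemma eq_nskips a b i : (forall t, (t < i)%N -> a t = b t) -> nskips a i = nskips b i.
Proof.
elim: i => //= i IH E; rewrite IH ?E // => t lt; apply: E; exact: ltnW.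
Qed.

Definition mnm_fun n (u : 'X_{1..n}) t := nth 0%N u t.

Lemma mnm_funE n (u : 'X_{1..n}) (i : 'I_n) : mnm_fun u i = u i.
Proof. by rewrite /mnm_fun -mnm_nth. Qed.

Section Greedy.
Variables (n : nat) (u : 'X_{1..n}) (S : {set 'I_n}).
Local Notation a := (mnm_fun u).

Let s i := #|[set j in S | (j < i)%N]|.

Let s0 : s 0 = 0%N.
Proof. by rewrite /s (_ : [set _ in _ | _] = set0) ?cards0 //; apply/setP => j;
  rewrite !inE andbF. Qed.

Let sS (i : 'I_n) : s i.+1 = (s i + (i \in S))%N.
Proof.
rewrite /s (cardsD1 i) !inE ltnSn andbT addnC; congr (_ + _)%N.
apply: eq_card => j; rewrite !inE ltnS leq_eqVlt -(inj_eq val_inj) /=.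
by case: ltngtP; rewrite ?andbF.
Qed.

Let s_leq i : (s i <= i)%N.
Proof.
rewrite -[X in (_ <= X)%N](size_iota 0) /s cardE -(size_map val);
  apply: uniq_leq_size.
  by rewrite map_inj_uniq ?enum_uniq //; apply: val_inj.
by move=> x /mapP[j]; rewrite mem_enum !inE => /andP[_ lt] ->; rewrite mem_iota.
Qed.

Let sn : s n = #|S|.
Proof. by apply: eq_card => j; rewrite !inE ltn_ord andbT. Qed.

(** The greedy set is at every stage at least as large as its competitor [S]. If
    both have the same size before [i], an exponent that admits [i] to [S] also
    admits it to the greedy set. *)
Lemma nskips_greedy : (skip_monomial S <= u)%MM -> (#|S| <= nskips a n)%N.
Proof.
move=> /mnm_lepP leS; rewrite -sn.
suff H i : (i <= n)%N -> (s i <= nskips a i)%N by apply: H.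
elim: i => [|i IH] lt_in; first by rewrite s0.
rewrite (sS (Ordinal lt_in)) /=.
have := leS (Ordinal lt_in); rewrite mnmE -mnm_funE /= -/(s i).
have := IH (ltnW lt_in); have := s_leq i.
by case: (_ \in S); case: ltnP; lia.
Qed.

(** Goodness only excludes sets of one size, so the greedy set is cut off at size
    [m]; before the cut the greedy rule is exactly the divisibility condition. *)
Lemma nskips_skip m : (forall i : 'I_n, (i \in S) =
    (i - nskips a i < a i)%N && (nskips a i < m)%N) ->
  (skip_monomial S <= u)%MM /\ #|S| = minn (nskips a n) m.
Proof.
move=> SE.
have sE i : (i <= n)%N -> s i = minn (nskips a i) m.
  elim: i => [|i IH] lt_in; first by rewrite s0 min0n.
  rewrite (sS (Ordinal lt_in)) SE /= IH; last exact: ltnW.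
  by case: (_ < a i)%N; case: ltnP; lia.
split; last by rewrite -sn sE.
apply/mnm_lepP => i; rewrite mnmE -/(s i) -mnm_funE; case: ifP => //.
rewrite SE sE; last exact: ltnW.
by have := nskips_leq a i; lia.
Qed.
End Greedy.

Lemma good_nskips n k r (u : 'X_{1..n}) :
  goodb k r u = (nskips (mnm_fun u) n <= n - r)%N &&
                [forall i : 'I_n, u i < k + i.+1]%N.
Proof.
rewrite /goodb; congr (_ && _); last by apply: eq_forallb => i; rewrite lemU ltnNge.
apply/forallP/idP => [gS|le S].
  rewrite leqNgt; apply/negP => lt.
  pose a := mnm_fun u.
  pose S := [set i : 'I_n | (i - nskips a i < a i)%N && (nskips a i < n - r + 1)%N].
  have [|leS cS] := @nskips_skip n u S (n - r + 1); first by move=> i; rewrite inE.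
  by have := implyP (gS S); rewrite cS leS; case: eqP => [_ /(_ isT)|]; lia.
apply/implyP => /eqP cS; apply/negP => /nskips_greedy; rewrite cS; lia.
Qed.

(** * Counting good exponents by degree *)

Section Count.
Variable k : nat.

Fixpoint box (p : nat) : seq (seq nat) :=
  if p is p'.+1 then [seq rcons l a | l <- box p', a <- iota 0 (k + p)] else [:: [::]].

Lemma boxP p (l : seq nat) :
  reflect (size l = p /\ forall t, (t < p)%N -> (nth 0 l t < k + t.+1)%N) (l \in box p).
Proof.
elim: p l => [|p IH] l.
  rewrite /= inE -size_eq0; apply: (iffP eqP) => [->|[] //]; first by split.
apply: (iffP allpairsP) => [[[l' a] /= [/IH[sl bl]]]|[]].
  rewrite mem_iota => lta ->; rewrite size_rcons sl; split=> // t ltt.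
  rewrite nth_rcons sl; case: (ltngtP t p) => [/bl //|gt|E]; lia.
case/lastP: l => [|l a] //; rewrite size_rcons => -[sl] bl.
exists (l, a); split=> //=.
  apply/IH; split=> // t lt; have := bl t (ltnW lt).
  by rewrite nth_rcons sl lt.
have := bl p (ltnSn p); rewrite nth_rcons sl ltnn eqxx mem_iota; lia.
Qed.

Lemma uniq_box p : uniq (box p).
Proof.
elim: p => //= p IH; apply: allpairs_uniq => //; first exact: iota_uniq.
by move=> [l a] [l' a'] /= _ _ /rcons_inj[-> ->].
Qed.

Definition skipgf p c : {poly rat} :=
  \sum_(l <- box p | nskips (nth 0%N l) p == c) 'X^(sumn l).

Lemma sum_iota_Xn b m : \sum_(a <- iota b m) 'X^a = 'X^b * qint m :> {poly rat}.
Proof.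
elim: m b => [|m IH] b; first by rewrite big_nil qint0 mulr0.
rewrite big_cons IH -[in RHS]add1n qintD mulrDr mulrA -exprSr.
by rewrite {2}/qint big_ord1 expr0 mulr1.
Qed.

Lemma skipgfS p c : skipgf p.+1 c =
   \sum_(l <- box p) 'X^(sumn l) * \sum_(a <- iota 0 (k + p.+1) |
      (nskips (nth 0%N l) p + (p - nskips (nth 0%N l) p < a) == c)%N) 'X^a.
Proof.
rewrite /skipgf big_mkcond /= big_allpairs_dep /= big_seq [RHS]big_seq.
apply: eq_bigr => l /boxP[sl _].
rewrite [in RHS]big_mkcond mulr_sumr; apply: eq_bigr => a _.
have -> : nskips (nth 0%N (rcons l a)) p = nskips (nth 0%N l) p.
  by apply: eq_nskips => t lt; rewrite nth_rcons sl lt.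
rewrite nth_rcons sl ltnn eqxx sumn_rcons exprD.
by case: ifP => _; rewrite ?mulr0.
Qed.

(** With [s] skips so far, the exponents up to [p - s] make no skip and the
    remaining [k + s] ones make one. *)
Lemma sum_steps p c s : (s <= p)%N ->
  \sum_(a <- iota 0 (k + p.+1) | (s + (p - s < a) == c)%N) 'X^a =
  (if s == c then qint (p - s).+1 else 0) +
  (if s.+1 == c then 'X^((p - s).+1) * qint (k + s) else 0) :> {poly rat}.
Proof.
move=> le_sp; have -> : (k + p.+1 = (p - s).+1 + (k + s))%N by lia.
rewrite iotaD big_cat add0n; congr (_ + _).
  rewrite big_seq_cond; case: eqP => [->|ne].
    rewrite -[RHS]mul1r -[X in X * _](expr0 'X) -sum_iota_Xn [RHS]big_seq;
      apply: eq_bigl => a.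
    by rewrite mem_iota; case: ltnP; case: eqP; lia.
  by rewrite big1 // => a /andP[]; rewrite mem_iota; case: ltnP; lia.
rewrite big_seq_cond; case: eqP => [<-|ne].
  rewrite -sum_iota_Xn [RHS]big_seq; apply: eq_bigl => a.
  by rewrite mem_iota; case: ltnP; case: eqP; lia.
by rewrite big1 // => a /andP[]; rewrite mem_iota; case: ltnP; lia.
Qed.

Lemma skipgfS0 p : skipgf p.+1 0 = qint p.+1 * skipgf p 0.
Proof.
rewrite skipgfS mulr_sumr [RHS]big_mkcond; apply: eq_bigr => l _.
rewrite sum_steps ?nskips_leq // addr0; case: eqP => [->|_]; last by rewrite mulr0.
by rewrite subn0 mulrC.
Qed.

Lemma skipgfSS p c : (c <= p)%N -> skipgf p.+1 c.+1 =
  qint (p - c) * skipgf p c.+1 + 'X^((p - c).+1) * qint (k + c) * skipgf p c.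
Proof.
move=> le_cp; rewrite skipgfS /skipgf.
rewrite [X in _ = X + _]mulr_sumr [X in _ = _ + X]mulr_sumr.
rewrite [X in _ = X + _]big_mkcond [X in _ = _ + X]big_mkcond -big_split;
  apply: eq_bigr => l _ /=.
have le_sp := nskips_leq (nth 0%N l) p.
rewrite sum_steps // mulrDr eqSS; congr (_ + _).
  case: eqP => [E|_]; last by rewrite mulr0.
  by rewrite mulrC; congr (qint _ * _); lia.
by case: eqP => [->|_]; rewrite ?mulr0 // mulrC.
Qed.

Definition qrising c : {poly rat} := \prod_(0 <= i < c) qint (k + i).

(** Up to [q^c [p]!], the generating function is a q-binomial coefficient, stated
    here with its denominator cleared. *)
Lemma skipgfE p c : (c <= p)%N ->
  skipgf p c * qfact c = 'X^c * qfact p * qrising c.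
Proof.
elim: p c => [|p IH] [|c] //.
- by rewrite /skipgf big_cons big_nil /= /qrising big_geq // qfact0 !mulr1 addr0.
- move=> _; have := IH 0%N (leq0n p).
  by rewrite qfact0 !mulr1 skipgfS0 qfactS /qrising big_geq // => ->;
    rewrite !mulr1 !mul1r mulrC.
move=> lec; have {lec} le_cp : (c <= p)%N := lec.
have E1 := IH c le_cp.
have E2 : qint (p - c) * (skipgf p c.+1 * qfact c.+1) =
          qint (p - c) * ('X^(c.+1) * qfact p * qrising c.+1).
  move: le_cp; rewrite leq_eqVlt => /orP[/eqP->|lt];
    first by rewrite subnn qint0 !mul0r.
  by rewrite IH.
have rS : qrising c.+1 = qrising c * qint (k + c) by rewrite /qrising big_nat_recr.
rewrite skipgfSS // mulrDl -[X in X + _]mulrA E2 [qfact c.+1]qfactS.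
have -> : 'X^((p - c).+1) * qint (k + c) * skipgf p c * (qfact c * qint c.+1) =
  'X^((p - c).+1) * qint (k + c) * qint c.+1 * (skipgf p c * qfact c) by ring.
rewrite E1 [qfact p.+1]qfactS rS.
have -> : qint p.+1 = qint (p - c) + 'X^(p - c) * qint c.+1.
  by rewrite -qintD; congr qint; lia.
rewrite !exprS; ring.
Qed.

Definition goodgf n N : {poly rat} :=
  \sum_(l <- box n | (nskips (nth 0%N l) n <= N)%N) 'X^(sumn l).

Lemma goodgf0 n : goodgf n 0 = skipgf n 0.
Proof. by apply: eq_bigl => l; rewrite leqn0. Qed.

Lemma goodgfS n N : goodgf n N.+1 = goodgf n N + skipgf n N.+1.
Proof.
rewrite /goodgf (bigID (fun l => nskips (nth 0%N l) n <= N)%N) /=.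
congr (_ + _); apply: eq_bigl => l; first by lia.
by case: eqP; lia.
Qed.

End Count.

Lemma qrising_fact k c : qrising k.+1 c * qfact k = qfact (k + c).
Proof.
rewrite /qrising; elim: c => [|c IH]; first by rewrite big_geq // mul1r addn0.
by rewrite big_nat_recr //= mulrAC IH addnS qfactS addSn.
Qed.

(** The hockey-stick identity for q-binomial coefficients, multiplied by
    [[n]!]. *)
Lemma goodgfE k n N : (N <= n)%N ->
  goodgf k n N * (qfact N * qfact k) = qfact n * qfact (k + N).
Proof.
elim: N => [|N IH] le_Nn.
  rewrite goodgf0 addn0 qfact0 mul1r; have := @skipgfE k n 0 (leq0n n).
  by rewrite qfact0 mulr1 => ->; rewrite /qrising big_geq // mulr1 mul1r.
rewrite goodgfS mulrDl.
have -> : goodgf k n N * (qfact N.+1 * qfact k) =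
  goodgf k n N * (qfact N * qfact k) * qint N.+1 by rewrite qfactS; ring.
rewrite IH; last exact: ltnW.
rewrite [X in _ + X]mulrA skipgfE // -[X in _ + X]mulrA.
have -> : qrising k N.+1 * qfact k = qint k * qfact (k + N).
  rewrite -qrising_fact mulrA /qrising.
  rewrite big_nat_recl // addn0; congr (_ * _ * _).
  by apply: eq_bigr => i _; rewrite addnS.
have -> : qfact (k + N.+1) = qfact (k + N) * (qint N.+1 + 'X^(N.+1) * qint k).
  by rewrite addnS qfactS -qintD addSn [(N + k)%N]addnC.
ring.
Qed.

Lemma goodgf_qbinom k n N : (N <= n)%N -> goodgf k n N = qbinom (N + k) k * qfact n.
Proof.
move=> le_Nn; apply: (mulIf (mulf_neq0 (qfact_neq0 N) (qfact_neq0 k))).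
by rewrite goodgfE // -qbinomE [(N + k)%N]addnC; ring.
Qed.

(** Pascal's rule; it matches the map from R_{n,k,r} to R_{n,k+1,r} given by
    multiplication by e_(n-r), where [n - r = N + 1]. *)
Lemma goodgf_rec k n N : (N < n)%N ->
  goodgf k.+1 n N.+1 = goodgf k.+1 n N + 'X^(N.+1) * goodgf k n N.+1.
Proof.
move=> lt_Nn.
have nz : qfact N.+1 * qfact k.+1 != 0 by rewrite mulf_neq0 ?qfact_neq0.
apply: (mulIf nz); rewrite goodgfE // mulrDl.
have -> : goodgf k.+1 n N * (qfact N.+1 * qfact k.+1) =
  goodgf k.+1 n N * (qfact N * qfact k.+1) * qint N.+1 by rewrite qfactS; ring.
rewrite goodgfE; last exact: ltnW.
have -> : 'X^(N.+1) * goodgf k n N.+1 * (qfact N.+1 * qfact k.+1) =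
  'X^(N.+1) * (goodgf k n N.+1 * (qfact N.+1 * qfact k)) * qint k.+1.
  by rewrite [qfact k.+1]qfactS; ring.
rewrite goodgfE //.
have -> : qfact (k.+1 + N.+1) = qfact (k + N.+1) * (qint N.+1 + 'X^(N.+1) * qint k.+1).
  by rewrite addSn qfactS -qintD [(N.+1 + _)%N]addnC addSn.
rewrite addSnnS; ring.
Qed.

Section GoodList.
Variable n : nat.

Definition mnm_of (l : seq nat) : 'X_{1..n} := [multinom nth 0%N l i | i < n].

Definition good_list k r d : seq 'X_{1..n} :=
  [seq mnm_of l | l <- box k n & (nskips (nth 0%N l) n <= n - r)%N && (sumn l == d)].

Lemma mnm_fun_of (l : seq nat) t : size l = n -> mnm_fun (mnm_of l) t = nth 0%N l t.
Proof.
move=> sl; case: (ltnP t n) => [lt|ge]; last first.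
  by rewrite /mnm_fun !nth_default ?sl ?size_tuple.
by have := mnm_funE (mnm_of l) (Ordinal lt); rewrite mnmE.
Qed.

Lemma mdeg_mnm_of (l : seq nat) : size l = n -> mdeg (mnm_of l) = sumn l.
Proof.
move=> sl; rewrite mdegE sumnE (big_nth 0%N) sl big_mkord.
by apply: eq_bigr => i _; rewrite mnmE.
Qed.

Lemma mem_good_list k r d u : (u \in good_list k r d) = goodb k r u && (mdeg u == d).
Proof.
rewrite good_nskips; apply/mapP/andP.
  move=> [l]; rewrite mem_filter => /andP[/andP[ls ld] /boxP[sl bl]] ->.
  rewrite mdeg_mnm_of //; split=> //; apply/andP; split.
    by rewrite (eq_nskips (b := nth 0%N l)) // => t _; rewrite mnm_fun_of.
  by apply/forallP => i; rewrite mnmE; apply: bl.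
move=> [/andP[us /forallP ub] ud].
have E : u = mnm_of u by apply/mnmP => i; rewrite mnmE -mnm_nth.
exists (val u : seq nat) => //; rewrite mem_filter us /=.
have -> : sumn u = mdeg u by rewrite /mdeg sumnE.
rewrite ud /=; apply/boxP; rewrite size_tuple; split=> // t lt.
by have := ub (Ordinal lt); rewrite (mnm_nth 0%N).
Qed.

Lemma uniq_good_list k r d : uniq (good_list k r d).
Proof.
rewrite map_inj_in_uniq; first by rewrite filter_uniq ?uniq_box.
move=> l l'; rewrite !mem_filter => /andP[_ /boxP[sl _]] /andP[_ /boxP[sl' _]] E.
apply: (@eq_from_nth _ 0%N); first by rewrite sl.
by move=> t _; rewrite -!mnm_fun_of // E.
Qed.

Lemma coef_goodgf k r d : (goodgf k n (n - r))`_d = (size (good_list k r d))%:R.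
Proof.
rewrite size_map -sum1_size big_filter /goodgf coef_sum natr_sum.
rewrite big_mkcond [RHS]big_mkcond.
apply: eq_bigr => l _; case: (_ <= _)%N => //=; rewrite coefXn eq_sym.
by case: eqP.
Qed.

Lemma size_good_list_rec k r d : (r < n)%N ->
  size (good_list k.+1 r d) = (size (good_list k.+1 r.+1 d) +
     (if d < n - r then 0 else size (good_list k r (d - (n - r)))))%N.
Proof.
move=> lt_rn; apply/eqP; rewrite -(Num.Theory.eqr_nat rat) natrD -!coef_goodgf.
have -> : (n - r = (n - r.+1).+1)%N by lia.
rewrite goodgf_rec ?coefD; last by lia.
rewrite coefXnM; apply/eqP; congr (_ + _).
case: ifP => // _; rewrite -coef_goodgf; congr (goodgf _ _ _)`_ _; lia.
Qed.

End GoodList.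

(** * Linear algebra modulo a subspace *)

(** A spanning family of the size of an independent family is independent. The
    quotient by [I] is not formed: [I] is only closed under linear combinations.
    The matrix [A] that expresses [v] through [b] is invertible, because a row
    vector in its kernel would be a relation between the [v i]. *)
Lemma exchange (F : fieldType) (V : lmodType F) (I : V -> Prop) N (v b : 'I_N -> V) :
  I 0 -> (forall x y, I x -> I y -> I (x + y)) -> (forall c x, I x -> I (c *: x)) ->
  (forall i, exists a : 'I_N -> F, I (v i - \sum_j a j *: b j)) ->
  (forall c : 'I_N -> F, I (\sum_i c i *: v i) -> forall i, c i = 0) ->
  forall c : 'I_N -> F, I (\sum_j c j *: b j) -> forall j, c j = 0.
Proof.
move=> I0 ID IZ /fin_all_exists[a Ia] free.
pose A := \matrix_(i, j) a i j.
have comb (u : 'rV_N) : I (\sum_j (u *m A) 0 j *: b j) -> u = 0.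
  move=> Iu; apply/rowP => i; rewrite mxE.
  apply: (free (fun i => u 0 i)).
  have -> : \sum_i u 0 i *: v i =
      \sum_i u 0 i *: (v i - \sum_j a i j *: b j) + \sum_j (u *m A) 0 j *: b j.
    have -> : \sum_j (u *m A) 0 j *: b j = \sum_i u 0 i *: \sum_j a i j *: b j.
      under eq_bigr => j _ do rewrite mxE scaler_suml.
      rewrite exchange_big; apply: eq_bigr => l _; rewrite scaler_sumr.
      by apply: eq_bigr => j _; rewrite mxE scalerA.
    by rewrite -big_split; apply: eq_bigr => l _ /=; rewrite -scalerDr subrK.
  apply: (ID) => //; apply: big_ind => [||l _]; [exact: I0|exact: ID|exact: IZ].
have unitA : A \in unitmx.
  rewrite -row_free_unit -kermx_eq0; apply/rowV0P => u /sub_kermxP uA.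
  by apply: comb; rewrite uA big1 // => j _; rewrite mxE scale0r.
move=> c Ic j; pose u := (\row_j c j) *m invmx A.
have uA : u *m A = \row_j c j by rewrite mulmxKV.
suff u0 : u = 0 by have := congr1 (fun w : 'rV_N => w 0 j) uA;
  rewrite u0 mul0mx !mxE.
by apply: comb; rewrite uA; under eq_bigr => l _ do rewrite mxE.
Qed.

Section MonomialSums.
Variables (n : nat) (L : seq 'X_{1..n}).
Hypothesis uniqL : uniq L.

Lemma mcoeff_sum_monomials (c : 'I_(size L) -> rat) (i : 'I_(size L)) :
  (\sum_j c j *: 'X_[nth 0%MM L j])@_(nth 0%MM L i) = c i.
Proof.
rewrite raddf_sum /= (bigD1 i) //= mcoeffZ mcoeffX eqxx mulr1 big1 ?addr0 // => j ne.
by rewrite mcoeffZ mcoeffX nth_uniq // (inj_eq val_inj) (negbTE ne) mulr0.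
Qed.

Lemma msupp_sum_monomials (c : 'I_(size L) -> rat) m :
  m \in msupp (\sum_j c j *: 'X_[nth 0%MM L j]) -> m \in L.
Proof.
elim/big_ind: _ => [|p q IHp IHq|j _]; first by rewrite msupp0.
  by move=> /msuppD_le; rewrite mem_cat => /orP[/IHp|/IHq].
by move=> /msuppZ_le; rewrite msuppX inE => /eqP->; apply: mem_nth.
Qed.

Lemma sum_monomialsE (q : {mpoly rat[n]}) : {subset msupp q <= L} ->
  q = \sum_(j < size L) q@_(nth 0%MM L j) *: 'X_[nth 0%MM L j].
Proof.
move=> sub; apply/mpolyP => m; case: (boolP (m \in L)) => [mL|nmL].
  rewrite -(nth_index 0%MM mL);
    have lt : (index m L < size L)%N by rewrite index_mem.
  by have := mcoeff_sum_monomials (fun j => q@_(nth 0%MM L j)) (Ordinal lt) => /= ->.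
rewrite !memN_msupp_eq0 //; last by apply: contra nmL; apply: sub.
by apply: contra nmL; apply: msupp_sum_monomials.
Qed.
End MonomialSums.

(** * Independence of the good monomials, by induction on r *)

Section Induction.
Variables (n k r : nat).
Hypothesis lt_rn : (r < n)%N.
Local Notation P := {mpoly rat[n]}.
Local Notation e := (esym (xvars n) (n - r)).

Let le_rn : (r <= n)%N := ltnW lt_rn.

(** The monomials of which the multiples by e_(n-r) complete, in degree [d], the
    good monomials for [r + 1] to a spanning family modulo the ideal for [r]. *)
Definition cofactor_list d :=
  if (d < n - r)%N then [::] else @good_list n k r (d - (n - r))%N.

Lemma Inkr_split_good d (p : P) : p \is d.-homog -> Inkr n k.+1 r.+1 p ->
  exists2 q, {subset msupp q <= cofactor_list d} & Inkr n k.+1 r (p - e * q).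
Proof.
move=> hp Ip; have [q Iq] := Inkr_split lt_rn Ip.
have := Inkr_pihomog d le_rn Iq.
rewrite pihomogB (pihomog_dE hp) mulrC (pihomogMr _ _ (homog_esym_xvars n (n - r))).
set q1 := \sum_(m <- _ | _) _ => {}Iq; rewrite /cofactor_list.
case: ltnP => [lt|le].
  exists 0; first by move=> m; rewrite msupp0.
  move: Iq; rewrite /q1 big1 ?mul0r ?mulr0 // => m /eqP dm; lia.
have hq1 : q1 \is (d - (n - r)).-homog.
  rewrite rpred_sum // => m /eqP dm; rewrite rpredZ // dhomogX -dm addnK;
    exact: eqxx.
have [q2 Iq2 sq2] := reduce_homog k le_rn hq1.
exists q2; first by move=> m /sq2[gm dm]; rewrite mem_good_list gm dm eqxx.
have -> : p - e * q2 = (p - q1 * e) + e * (q1 - q2) by ring.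
by apply: ideal_genD => //; apply: Inkr_lift.
Qed.

(** The spanning family of good monomials for [r + 1] and of multiples of
    e_(n-r) has, by Pascal's rule, as many members as there are good monomials
    for [r], which are independent; so it is independent. A member [p] of the
    ideal for [r + 1] is congruent to a combination of multiples of e_(n-r) modulo
    the ideal for [r], hence zero. *)
Lemma good_free_homog d (p : P) : good_free n k.+1 r -> p \is d.-homog ->
  {in msupp p, forall u, goodb k.+1 r.+1 u} -> Inkr n k.+1 r.+1 p -> p = 0.
Proof.
move=> free hp gp Ip.
pose L0 := @good_list n k.+1 r d; pose L1 := @good_list n k.+1 r.+1 d.
pose L2 := cofactor_list d.
have uL0 : uniq L0 by apply: uniq_good_list.
have uL1 : uniq L1 by apply: uniq_good_list.
have uL2 : uniq L2 by rewrite /L2 /cofactor_list; case: ifP => // _;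
  apply: uniq_good_list.
have sL : size L0 = (size L1 + size L2)%N.
  rewrite [LHS]size_good_list_rec //; congr (_ + _)%N.
  by rewrite /L2 /cofactor_list; case: ifP.
pose v (i : 'I_(size L1 + size L2)) : P := 'X_[nth 0%MM L0 i].
pose b (j : 'I_(size L1 + size L2)) : P :=
  match split j with
  | inl j1 => 'X_[nth 0%MM L1 j1] | inr j2 => e * 'X_[nth 0%MM L2 j2] end.
pose coefs (q1 q2 : P) (j : 'I_(size L1 + size L2)) :=
  match split j with
  | inl j1 => q1@_(nth 0%MM L1 j1) | inr j2 => q2@_(nth 0%MM L2 j2) end.
have combE q1 q2 : {subset msupp q1 <= L1} -> {subset msupp q2 <= L2} ->
    \sum_j coefs q1 q2 j *: b j = q1 + e * q2.
  move=> s1 s2; rewrite big_split_ord [in RHS](sum_monomialsE uL1 s1).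
  rewrite [in RHS](sum_monomialsE uL2 s2) /=.
  rewrite mulr_sumr; congr (_ + _); apply: eq_bigr => j _; rewrite /coefs /b.
    by rewrite (unsplitK (inl j)).
  by rewrite (unsplitK (inr j)) scalerAr.
(* The family [b] spans the polynomials of degree [d]. *)
have homogI q : q \is d.-homog -> exists q1 q2, [/\ {subset msupp q1 <= L1},
    {subset msupp q2 <= L2} & Inkr n k.+1 r (q - (q1 + e * q2))].
  move=> hq; have [q1 I1 s1] := reduce_homog k.+1 lt_rn hq.
  have hq1 : q1 \is d.-homog by apply/dhomogP => m /s1[].
  have hd : q - q1 \is d.-homog by rewrite rpredB.
  have [q2 s2 I2] := Inkr_split_good hd I1.
  exists q1, q2; split=> //; last by rewrite opprD addrA.
  by move=> m /s1[gm dm]; rewrite mem_good_list gm dm eqxx.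
have sp : {subset msupp p <= L1}.
  by move=> m mp; rewrite mem_good_list gp //=; apply/eqP; move/dhomogP: hp; apply.
have [q2 s2 I2] := Inkr_split_good hp Ip.
have s2N : {subset msupp (- q2) <= L2} by move=> m;
  rewrite (perm_mem (msuppN _)); apply: s2.
have zero : forall j, coefs p (- q2) j = 0.
  apply: (exchange (v := v) (b := b) (I := Inkr n k.+1 r)).
  - exact: ideal_gen0.
  - exact: ideal_genD.
  - by move=> c x Ix; rewrite -mul_mpolyC; apply: ideal_genM.
  - move=> i; have hv : v i \is d.-homog.
      have : nth 0%MM L0 i \in L0 by apply: mem_nth; rewrite sL.
      by rewrite mem_good_list dhomogX => /andP[].
    have [q1' [q2' [s1' s2' I']]] := homogI _ hv.
    by exists (coefs q1' q2'); rewrite combE.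
  - move=> c Ic i; move: c Ic i; rewrite /v; case: _ / sL => c Ic i.
    rewrite -[LHS](mcoeff_sum_monomials uL0 c i) (free _ _ Ic) ?mcoeff0 //.
    move=> m /msupp_sum_monomials; rewrite mem_good_list => /andP[].
    done.
  by rewrite combE // mulrN.
rewrite (sum_monomialsE uL1 sp) big1 // => j _.
have := zero (lshift _ j); rewrite /coefs (unsplitK (inl j)) => ->.
by rewrite scale0r.
Qed.

Lemma good_free_step : good_free n k.+1 r -> good_free n k.+1 r.+1.
Proof.
move=> free p gp Ip; apply/mpolyP => u; rewrite mcoeff0.
have := mcoeff_pihomog (mdeg u) p u; rewrite eqxx => <-.
set pu := pihomog _ _ _.
rewrite (@good_free_homog (mdeg u) pu free) ?mcoeff0 ?pihomogP //.
  move=> v; rewrite mcoeff_msupp mcoeff_pihomog; case: ifP => [_|];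
    last by rewrite eqxx.
  by rewrite -mcoeff_msupp; apply: gp.
exact: Inkr_pihomog.
Qed.
End Induction.

Lemma good_free_all n k r : (r <= n)%N -> good_free n k r.
Proof.
elim: r => [|r IH] lt_rn; first exact: good_free0.
have {IH} free := IH (ltnW lt_rn).
case: k free => [|k] free; last exact: good_free_step.
move=> p gp Ip; apply: free; last exact: Inkr0_mono.
move=> u /gp; rewrite !good_nskips => /andP[le ->]; rewrite andbT.
by apply: leq_trans le _; lia.
Qed.

(** * The standard monomials and the Hilbert series *)

Theorem theorem3p6 (n k r : nat) (le_rn : (r <= n)%N) :
  (forall m : 'X_{1..n},
     standard_monomial (Inkr n k r) m <-> good_monomial n k r m) /\
  has_hilbert_series (Inkr n k r) (qbinom (n + k - r) k * qfact n).
Proof.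
have free := @good_free_all n k r le_rn.
split=> [m|d].
  split=> [sm|/goodP gm]; first by apply/goodP; apply: standard_good sm.
  exact: good_standard.
pose L := @good_list n k r d.
exists (size L); last first.
  rewrite -coef_goodgf goodgf_qbinom ?leq_subr //; congr (qbinom _ _ * _)`_ _; lia.
have uL : uniq L by apply: uniq_good_list.
exists (fun i => 'X_[nth 0%MM L i]); split.
- move=> i; rewrite dhomogX.
  by have := mem_nth 0%MM (ltn_ord i); rewrite mem_good_list => /andP[].
- move=> c Ic i; rewrite -[LHS](mcoeff_sum_monomials uL c i) (free _ _ Ic) ?mcoeff0 //.
  by move=> m /msupp_sum_monomials; rewrite mem_good_list => /andP[].
move=> p hp; have [q Iq sq] := reduce_homog k le_rn hp.
exists (fun i => q@_(nth 0%MM L i)); rewrite -sum_monomialsE //.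
by move=> m /sq[gm dm]; rewrite mem_good_list gm dm eqxx.
Qed.
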